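(* Let $E$ and $F$ be infinite dimensional Banach lattices with $E$ non-reflexive. Then either the Wittstock tensor product $E\widetilde{\otimes}_{|\varepsilon|}F$ fails to be a Grothendieck space, or both $E^{\ast}$ and $F^{\ast}$ fail the bounded positive approximation property (the ''or'' being inclusive).
   Context: Banach lattices are real. Regular norm: for Banach lattices $X,Y$, an operator $T:X\to Y$ is positive if $T(X_+)\subseteq Y_+$; $\mathscr{L}_r(X,Y)$ is the space of differences of positive operators, with norm $\|T\|_r=\inf\{\|S\| : S:X\to Y \text{ positive}, |T(x)|\le S(|x|)\ \forall x\in X\}$. Wittstock tensor product: each $u=\sum_i x_i\otimes y_i\in E\otimes F$ defines the finite rank operator $T_u:E^{\ast}\to F$, $T_u(x^{\ast})=\sum_i \langle x_i,x^{\ast}\rangle y_i$. The Wittstock norm is $\|u\|_{|\varepsilon|}=\|T_u\|_r$, the regular norm in $\mathscr{L}_r(E^{\ast},F)$. $E\widetilde{\otimes}_{|\varepsilon|}F$ is the completion of $E\otimes F$ in this norm, i.e. the closure of $E\otimes F$ in $\mathscr{L}_r(E^{\ast},F)$ for the regular norm, ordered by positivity of operators; it is a Banach lattice. Bounded positive approximation property (BPAP): a Banach lattice $X$ has the BPAP if there is $1\le\lambda<\infty$ such that for every compact $C\subseteq X$ and every $\varepsilon>0$ there is a finite rank positive operator $T:X\to X$ with $\|T\|\le\lambda$ and $\|x-T(x)\|\le\varepsilon$ for all $x\in C$. A Banach space $X$ is a Grothendieck space if every weak-star null sequence in $X^{\ast}$ is weakly null. *)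

(* Defs.v *)
From HB Require Import structures.
From mathcomp Require Import all_boot all_order all_algebra.
From mathcomp Require Import boolp classical_sets functions reals.
From mathcomp Require Import topology normedtype sequences.
From mathcomp Require Import lra.

Set Implicit Arguments.
Unset Strict Implicit.
Unset Printing Implicit Defensive.

Import Order.TTheory GRing.Theory Num.Theory.
Import numFieldNormedType.Exports.

Local Open Scope classical_set_scope.
Local Open Scope ring_scope.

Section BoundedOperators.
Context {R : realType}.

Definition bounded_op (X Y : normedModType R) : {pred X -> Y} :=
  [pred f : X -> Y | `[< linear f /\ continuous f >]].
Arguments bounded_op : clear implicits.

(* Bounded linear operators, with the operator norm [opnorm]. *)
Record bop (X Y : normedModType R) : Type :=
  Bop { bop_fun :> X -> Y ; _ : bop_fun \in bounded_op X Y }.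

HB.instance Definition _ X Y := [isSub for @bop_fun X Y].
HB.instance Definition _ X Y := [Choice of bop X Y by <:].

Lemma bopP X Y (T : bop X Y) : linear T /\ continuous T.
Proof. by have /asboolP := valP T. Qed.

HB.instance Definition _ X Y (T : bop X Y) :=
  GRing.isLinear.Build R X Y *:%R (bop_fun T) (bopP T).1.

Lemma bounded_op_submod (X Y : normedModType R) : submod_closed (bounded_op X Y).
Proof.
split.
  apply/asboolP; split; last exact: cst_continuous.
  by move=> a x y /=; rewrite scaler0 addr0.
move=> a f g /asboolP[lf cf] /asboolP[lg cg]; apply/asboolP; split.
  move=> b x y; rewrite !fctE lf lg !scalerDr !scalerA (mulrC a).
  by rewrite -!addrA; congr (_ + _); rewrite addrCA.
move=> x; apply: (@continuousD _ _ _ (fun x => a *: f x)); last exact: cg.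
by apply: continuousZr; exact: cf.
Qed.

HB.instance Definition _ X Y :=
  GRing.SubChoice_isSubLmodule.Build R _ _ (bop X Y)
    (@bounded_op_submod X Y).

Section OperatorNorm.
Context {X Y : normedModType R}.
Implicit Types T S : bop X Y.

Definition opnorm T : R := sup [set `|T x| | x in [set x : X | `|x| <= 1]].

Lemma bop_addE T S x : (T + S) x = T x + S x. Proof. by []. Qed.

Lemma bop_oppE T x : (- T) x = - T x. Proof. by []. Qed.

Lemma bop_subE T S x : (T - S) x = T x - S x. Proof. by []. Qed.

Lemma bop_scaleE (a : R) T x : (a *: T) x = a *: T x. Proof. by []. Qed.

Lemma bop_ext T S : (forall x, T x = S x) -> T = S.
Proof. by move=> TS; apply/val_inj/funext. Qed.

Lemma bop_bounded T : exists2 c : R, 0 <= c & forall x, `|T x| <= c * `|x|.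
Proof.
have /linear_bounded_continuous/linear_boundedP := (bopP T).2.
by move=> /pinfty_ex_gt0[c /ltW c0 Tc]; exists c.
Qed.

Lemma opnorm_has_ubound T :
  has_ubound [set `|T x| | x in [set x : X | `|x| <= 1]].
Proof.
have [c c0 Tc] := bop_bounded T; exists c => _ [x /= x1 <-].
by rewrite (le_trans (Tc x))// ler_piMr.
Qed.

Lemma opnorm_ge0 T : 0 <= opnorm T.
Proof.
rewrite (@le_trans _ _ `|T 0|)//; apply: ub_le_sup.
  exact: opnorm_has_ubound.
by exists 0 => //=; rewrite normr0.
Qed.

Lemma ler_opnorm T x : `|T x| <= opnorm T * `|x|.
Proof.
have [->|x0] := eqVneq x 0; first by rewrite linear0 !normr0 mulr0.
rewrite -ler_pdivrMr ?normr_gt0//; apply: ub_le_sup.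
  exact: opnorm_has_ubound.
exists (`|x|^-1 *: x) => /=.
  by rewrite normrZ ger0_norm ?invr_ge0// mulVf ?normr_eq0.
by rewrite linearZ/= normrZ ger0_norm ?invr_ge0// mulrC.
Qed.

Lemma opnorm_le T (c : R) :
  0 <= c -> (forall x, `|T x| <= c * `|x|) -> opnorm T <= c.
Proof.
move=> c0 Tc; apply: ge_sup; first by exists `|T 0|, 0 => //=; rewrite normr0.
by move=> _ [x /= x1 <-]; rewrite (le_trans (Tc x))// ler_piMr.
Qed.

Lemma ler_opnormD T S : opnorm (T + S) <= opnorm T + opnorm S.
Proof.
apply: opnorm_le; first by rewrite addr_ge0// opnorm_ge0.
move=> x; rewrite bop_addE (le_trans (ler_normD _ _))// mulrDl.
by rewrite lerD// ler_opnorm.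
Qed.

Lemma opnormZ_le (a : R) T : opnorm (a *: T) <= `|a| * opnorm T.
Proof.
apply: opnorm_le; first by rewrite mulr_ge0// opnorm_ge0.
by move=> x; rewrite bop_scaleE normrZ -mulrA ler_wpM2l// ler_opnorm.
Qed.

Lemma opnormZ (a : R) T : opnorm (a *: T) = `|a| * opnorm T.
Proof.
have [->|a0] := eqVneq a 0.
  apply/le_anti; rewrite (le_trans (opnormZ_le _ _))//=.
  by rewrite normr0 mul0r opnorm_ge0.
apply/le_anti; rewrite opnormZ_le/=.
have := opnormZ_le a^-1 (a *: T); rewrite scalerA mulVf// scale1r.
by rewrite normfV ler_pdivlMl ?normr_gt0.
Qed.

Lemma opnorm_eq0 T : opnorm T = 0 -> T = 0.
Proof.
move=> T0; apply: bop_ext => x; apply/eqP; rewrite -normr_le0.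
by have := ler_opnorm T x; rewrite T0 mul0r.
Qed.

HB.instance Definition _ := Lmodule_isNormed.Build R (bop X Y)
  ler_opnormD opnormZ opnorm_eq0.

Lemma bop_normE T : `|T| = opnorm T. Proof. by []. Qed.

Lemma linear_bop (f : X -> Y) (c : R) :
  linear f -> (forall x, `|f x| <= c * `|x|) -> f \in bounded_op X Y.
Proof.
move=> lf fc; apply/asboolP; split=> //.
pose g := GRing.isLinear.Build R X Y *:%R f lf.
pose h : {linear X -> Y} := HB.pack f g.
apply: (@bounded_linear_continuous _ _ _ h); apply/linear_boundedP.
near=> r => x; rewrite (le_trans (fc x))// ler_wpM2r//.
by near: r; apply: nbhs_pinfty_ge; rewrite num_real.
Unshelve. all: by end_near. Qed.

Lemma bopE_lin (f : X -> Y) (c : R) :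
  linear f -> (forall x, `|f x| <= c * `|x|) ->
  exists T : bop X Y, forall x, T x = f x.
Proof. by move=> lf fc; exists (Bop (linear_bop lf fc)). Qed.

End OperatorNorm.

End BoundedOperators.
Arguments bounded_op {R} X Y.

Section OperatorComplete.
Context {R : realType} {X : normedModType R} {Y : completeNormedModType R}.

Lemma bop_complete (F : set_system (bop X Y)) :
  ProperFilter F -> cauchy F -> cvg F.
Proof.
move=> FF Fc.
have Fe (e : R) : 0 < e -> exists2 A, F A &
    forall T S, A T -> A S -> forall x, `|T x - S x| <= e * `|x|.
  move=> e0; have := Fc; rewrite -cauchy_ballP => /(_ e e0)[[A B]/= [FA FB]] AB.
  exists (A `&` B); first exact: filterI.
  move=> T S [AT _] [_ BS] x; have := AB (T, S) (conj AT BS).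
  rewrite -ball_normE/= => /ltW TS.
  by rewrite -bop_subE (le_trans (ler_opnorm _ _))// ler_wpM2r.
have Fx x : cvg ((fun T : bop X Y => T x) @ F).
  apply: cauchy_cvg; apply/cauchy_ballP => e e0.
  have d0 : 0 < e / (`|x| + 1) by rewrite divr_gt0// ltr_wpDl.
  have [A FA Ae] := Fe _ d0.
  exists ((fun T : bop X Y => T x) @` A, (fun T : bop X Y => T x) @` A) => /=.
    by split; apply: (@filterS _ F _ A) => // T AT; exists T.
  move=> [_ _] [[T AT <-] [S AS <-]] /=; rewrite -ball_normE/=.
  rewrite (le_lt_trans (Ae _ _ AT AS x))// mulrAC ltr_pdivrMr ?ltr_wpDl//.
  by rewrite ltr_pM2l// ltrDl.
pose f x := lim ((fun T : bop X Y => T x) @ F).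
have lf : linear f.
  move=> a x y; apply: cvg_lim => //=.
  under eq_fun do rewrite linearP.
  by apply: cvgD; [apply: cvgZr; exact: Fx|exact: Fx].
have fE (e : R) : 0 < e -> exists2 A, F A &
    forall T, A T -> forall x, `|T x - f x| <= e * `|x|.
  move=> e0; have [A FA Ae] := Fe _ e0; exists A => // T AT x.
  have Tf : (fun S : bop X Y => `|T x - S x|) @ F --> `|T x - f x|.
    by apply: cvg_norm; apply: cvgB; [exact: cvg_cst|exact: Fx].
  apply: (closed_cvg _ (@closed_le R (e * `|x|)) _ _ Tf).
  by apply: (@filterS _ F _ A) => // S AS; exact: Ae.
have [A FA Af] := fE _ ltr01.
have [T0 AT0] := @filter_ex _ F _ _ FA.
have fc x : `|f x| <= (1 + opnorm T0) * `|x|.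
  have -> : f x = T0 x - (T0 x - f x) by rewrite opprB addrC subrK.
  rewrite (le_trans (ler_normB _ _))// addrC mulrDl lerD ?ler_opnorm//.
  exact: Af.
have [g gE] := bopE_lin lf fc.
apply/cvg_ex; exists g; apply/cvgrPdist_le => e e0.
have [B FB Bf] := fE _ e0.
apply: (@filterS _ F _ B) => // T BT /=.
rewrite bop_normE; apply: opnorm_le; first exact: ltW.
by move=> x; rewrite bop_subE gE distrC; exact: Bf.
Qed.

HB.instance Definition _ := Uniform_isComplete.Build (bop X Y) bop_complete.

End OperatorComplete.

(* The norm of [E] is written [`|x|]; the modulus [x \/ (- x)] of the vector
   lattice is [labs x] below.  The library's [Order.POrder] and
   [Num.NormedZmodule] have no common descendant other than [Num.NumDomain] and
   no new one can be declared downstream, hence the order is a field. *)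
HB.mixin Record isBanachLattice (R : realType) E
    of CompleteNormedModule R E := {
  lle : rel E;
  ljoin : E -> E -> E;
  lmeet : E -> E -> E;
  lle_refl : reflexive lle;
  lle_anti : antisymmetric lle;
  lle_trans : transitive lle;
  lle_joinl : forall x y z, lle (ljoin x y) z = lle x z && lle y z;
  lle_meetr : forall x y z, lle z (lmeet x y) = lle z x && lle z y;
  lleD2r : forall z x y, lle x y -> lle (x + z) (y + z);
  lscale_ge0 : forall (a : R) x, 0 <= a -> lle 0 x -> lle 0 (a *: x);
  lnorm_le : forall x y,
    lle (ljoin x (- x)) (ljoin y (- y)) -> `|x| <= `|y|
}.

#[short(type="banachLatticeType")]
HB.structure Definition BanachLattice (R : realType) :=
  {E of CompleteNormedModule R E & isBanachLattice R E}.

Arguments lle_refl {R s} x.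
Arguments lle_anti {R s} [x y].
Arguments lle_trans {R s} [y x z].
Arguments lleD2r {R s} z [x y].
Arguments lscale_ge0 {R s} [a x].
Arguments lnorm_le {R s} [x y].
#[global] Hint Extern 0 (is_true (lle _ _)) => exact: lle_refl : core.

Notation "x <=l y" := (lle x y) (at level 70, no associativity) : ring_scope.

Section BanachLatticeTheory.
Context {R : realType} {E : banachLatticeType R}.
Implicit Types x y z : E.

Lemma lle_ljoin x y : x <=l ljoin x y.
Proof. by have := lle_joinl x y (ljoin x y); rewrite lle_refl => /esym/andP[]. Qed.

Lemma lle_rjoin x y : y <=l ljoin x y.
Proof. by have := lle_joinl x y (ljoin x y); rewrite lle_refl => /esym/andP[]. Qed.

Lemma lmeet_lel x y : lmeet x y <=l x.
Proof. by have := lle_meetr x y (lmeet x y); rewrite lle_refl => /esym/andP[]. Qed.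

Lemma lmeet_ler x y : lmeet x y <=l y.
Proof. by have := lle_meetr x y (lmeet x y); rewrite lle_refl => /esym/andP[]. Qed.

Lemma ljoinC x y : ljoin x y = ljoin y x.
Proof. by apply/lle_anti; rewrite !lle_joinl !lle_ljoin !lle_rjoin. Qed.

Definition labs x : E := ljoin x (- x).
Definition lpos x : E := ljoin x 0.
Definition lneg x : E := lpos (- x).

Lemma lleD x y z t : x <=l y -> z <=l t -> x + z <=l y + t.
Proof.
move=> xy zt; rewrite (lle_trans (lleD2r z xy))//.
by rewrite ![y + _]addrC lleD2r.
Qed.

Lemma lsubr_ge0 x y : (0 <=l y - x) = (x <=l y).
Proof.
by apply/idP/idP => [/(lleD2r x)|/(lleD2r (- x))];
  rewrite ?subrK ?add0r ?subrr.
Qed.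

Lemma lleN2 x y : (- x <=l - y) = (y <=l x).
Proof. by rewrite -lsubr_ge0 opprK addrC lsubr_ge0. Qed.

Lemma loppr_le0 x : (- x <=l 0) = (0 <=l x).
Proof. by rewrite -{1}oppr0 lleN2. Qed.

Lemma laddr_ge0 x y : 0 <=l x -> 0 <=l y -> 0 <=l x + y.
Proof. by move=> x0 y0; rewrite -(addr0 0) lleD. Qed.

Lemma lle_subl x y z : (x - y <=l z) = (x <=l z + y).
Proof. by rewrite -lsubr_ge0 opprB addrA lsubr_ge0. Qed.

Lemma lleZ2l (a : R) x y : 0 <= a -> x <=l y -> a *: x <=l a *: y.
Proof.
by move=> a0 xy; rewrite -lsubr_ge0 -scalerBr lscale_ge0// lsubr_ge0.
Qed.

Lemma lhalf_ge0 x : 0 <=l x + x -> 0 <=l x.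
Proof.
move=> x0; have -> : x = 2^-1 *: (x + x).
  by rewrite -mulr2n -(scaler_nat 2 x) scalerA mulVf ?scale1r ?pnatr_eq0.
by rewrite lscale_ge0// invr_ge0.
Qed.

Lemma le_labs x : x <=l labs x. Proof. exact: lle_ljoin. Qed.

Lemma leN_labs x : - x <=l labs x. Proof. exact: lle_rjoin. Qed.

Lemma labs_le x y : (labs x <=l y) = (x <=l y) && (- x <=l y).
Proof. exact: lle_joinl. Qed.

Lemma labs_ge0 x : 0 <=l labs x.
Proof.
by apply: lhalf_ge0; rewrite -(subrr x) lleD ?le_labs ?leN_labs.
Qed.

Lemma labsN x : labs (- x) = labs x.
Proof. by rewrite /labs opprK ljoinC. Qed.

Lemma ger0_labs x : 0 <=l x -> labs x = x.
Proof.
move=> x0; apply/lle_anti; rewrite le_labs andbT labs_le lle_refl/=.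
by rewrite (lle_trans _ x0)// loppr_le0.
Qed.

Lemma labs_id x : labs (labs x) = labs x.
Proof. by rewrite ger0_labs// labs_ge0. Qed.

Lemma norm_labs x : `|labs x| = `|x|.
Proof.
by apply/le_anti; rewrite !lnorm_le// -!/(labs _) labs_id.
Qed.

Lemma labs_norm_le x y : labs x <=l labs y -> `|x| <= `|y|.
Proof. exact: lnorm_le. Qed.

Lemma ler0_norm_le x y : 0 <=l x -> x <=l y -> `|x| <= `|y|.
Proof.
move=> x0 xy; apply: labs_norm_le; rewrite !ger0_labs//.
exact: lle_trans xy.
Qed.

Lemma labsD x y : labs (x + y) <=l labs x + labs y.
Proof.
by rewrite labs_le opprD !lleD ?le_labs ?leN_labs.
Qed.

Lemma labs0 : labs (0 : E) = 0.
Proof. by rewrite ger0_labs. Qed.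

Lemma labsZ_le (a : R) x : labs (a *: x) <=l `|a| *: labs x.
Proof.
have [a0|a0] := ger0P a.
  by rewrite labs_le -scalerN !lleZ2l ?le_labs ?leN_labs.
have aE : a *: x = (- a) *: (- x) by rewrite scalerN scaleNr opprK.
by rewrite labs_le -scaleNr aE !lleZ2l ?le_labs ?leN_labs ?oppr_ge0// ltW.
Qed.

Lemma lpos_ge0 x : 0 <=l lpos x. Proof. exact: lle_rjoin. Qed.

Lemma lneg_ge0 x : 0 <=l lneg x. Proof. exact: lpos_ge0. Qed.

Lemma le_lpos x : x <=l lpos x. Proof. exact: lle_ljoin. Qed.

Lemma ljoinD x y z : ljoin x y + z = ljoin (x + z) (y + z).
Proof.
apply/lle_anti; rewrite lle_joinl !lleD2r ?lle_ljoin ?lle_rjoin// andbT.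
by rewrite -[z in _ + z]opprK lle_subl lle_joinl -!lle_subl opprK lle_ljoin lle_rjoin.
Qed.

Lemma lpos_lneg x : x = lpos x - lneg x.
Proof.
apply/eqP; rewrite -subr_eq0 opprB addrA subr_eq0 addrC /lneg /lpos ljoinD.
by rewrite addNr add0r ljoinC.
Qed.

Lemma lpos_le_labs x : lpos x <=l labs x.
Proof. by rewrite lle_joinl le_labs labs_ge0. Qed.

Lemma lneg_le_labs x : lneg x <=l labs x.
Proof. by rewrite -labsN lpos_le_labs. Qed.

Lemma lpos2 x : lpos (x + x) = lpos x + lpos x.
Proof.
apply: lle_anti; apply/andP; split.
  by rewrite lle_joinl lleD ?le_lpos// laddr_ge0 ?lpos_ge0.
suff h : lpos x <=l 2^-1 *: lpos (x + x).
  rewrite (lle_trans (lleD h h))// -scalerDl.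
  by rewrite -[X in X + _]mul1r -[X in _ + X]mul1r -splitr scale1r.
have -> : lpos x = ljoin x 0 by [].
rewrite lle_joinl lscale_ge0 ?invr_ge0// ?lpos_ge0// andbT.
have {1}-> : x = 2^-1 *: (x + x).
  by rewrite -mulr2n -(scaler_nat 2 x) scalerA mulVf ?scale1r ?pnatr_eq0.
by rewrite lleZ2l ?invr_ge0// le_lpos.
Qed.

Lemma labs_lpos_lneg x : labs x = lpos x + lneg x.
Proof.
have -> : lneg x = lpos x - x by rewrite {3}[x]lpos_lneg opprB addrC subrK.
by rewrite addrA -lpos2 ljoinD add0r addrK.
Qed.


Lemma riesz_decomp x y z : 0 <=l x -> 0 <=l y -> 0 <=l z -> z <=l x + y ->
  exists z1 z2, [/\ z = z1 + z2, 0 <=l z1, z1 <=l x, 0 <=l z2 & z2 <=l y].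
Proof.
move=> x0 y0 z0 zxy; exists (lmeet z x), (z - lmeet z x).
rewrite addrC subrK lle_meetr z0 x0 lmeet_ler lsubr_ge0 lmeet_lel; split=> //.
by rewrite lle_subl addrC -lle_subl lle_meetr -lsubr_ge0 opprB addrC subrK y0
  lle_subl.
Qed.

End BanachLatticeTheory.

Section Dual.
Context {R : realType}.

Definition dual (X : normedModType R) : Type :=
  bop X [the normedModType R of R^o].

HB.instance Definition _ X := CompleteNormedModule.on (dual X).

Definition bop_of_dual X (f : dual X) : bop X [the normedModType R of R^o] := f.
Coercion bop_of_dual : dual >-> bop.

End Dual.

Section DualLattice.
Context {R : realType} {E : banachLatticeType R}.
Implicit Types (f g h : dual E) (x y z : E).

Lemma dual_ext f g : (forall x, f x = g x) -> f = g.
Proof. exact: bop_ext. Qed.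

Lemma ler_dual f x : `|f x| <= `|f| * `|x|.
Proof. exact: (ler_opnorm (f : bop E R^o)). Qed.

Lemma dual_norm_le f (c : R) :
  0 <= c -> (forall x, `|f x| <= c * `|x|) -> `|f| <= c.
Proof. exact: (@opnorm_le R E R^o f). Qed.

Lemma dualDE f g x : (f + g) x = f x + g x. Proof. by []. Qed.

Lemma dualNE f x : (- f) x = - f x. Proof. by []. Qed.

Lemma dual_extend (p : E -> R) (c : R) : 0 <= c ->
  (forall x y, 0 <=l x -> 0 <=l y -> p (x + y) = p x + p y) ->
  (forall (a : R) x, 0 <= a -> 0 <=l x -> p (a *: x) = a * p x) ->
  (forall x, 0 <=l x -> 0 <= p x) ->
  (forall x, 0 <=l x -> p x <= c * `|x|) ->
  (fun x => p (lpos x) - p (lneg x)) \in bounded_op E R^o.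
Proof.
move=> c0 pD pZ p0 pc; pose q x : R^o := p (lpos x) - p (lneg x).
have qE a b : 0 <=l a -> 0 <=l b -> q (a - b) = p a - p b.
  move=> a0 b0; have h : p (lpos (a - b)) + p b = p a + p (lneg (a - b)).
    rewrite -!pD ?lpos_ge0 ?lneg_ge0//; congr p.
    have -> : lpos (a - b) = (a - b) + lneg (a - b).
      by rewrite {2}[a - b]lpos_lneg subrK.
    by rewrite addrAC subrK.
  by rewrite /q; lra.
have qD x y : q (x + y) = q x + q y.
  have -> : x + y = (lpos x + lpos y) - (lneg x + lneg y).
    by rewrite {1}[x]lpos_lneg {1}[y]lpos_lneg opprD addrACA.
  by rewrite qE ?laddr_ge0 ?lpos_ge0 ?lneg_ge0// !pD ?lpos_ge0 ?lneg_ge0//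
    opprD addrACA.
have qZ0 a x : 0 <= a -> q (a *: x) = a * q x.
  move=> a0; have -> : a *: x = a *: lpos x - a *: lneg x.
    by rewrite -scalerBr -lpos_lneg.
  by rewrite qE ?lscale_ge0 ?lpos_ge0 ?lneg_ge0// !pZ ?lpos_ge0 ?lneg_ge0//
    -mulrBr.
have qN x : q (- x) = - q x.
  rewrite {1}[x]lpos_lneg opprB qE ?lpos_ge0 ?lneg_ge0//.
  by rewrite opprB.
have lq : linear q.
  move=> a x y; rewrite qD; congr (_ + _); have [a0|a0] := leP 0 a.
    exact: qZ0.
  rewrite -[a *: x]opprK -scaleNr qN qZ0 ?oppr_ge0 ?ltW//.
  by rewrite mulNr opprK.
apply: (@linear_bop _ _ _ _ (c + c)) => // x.
have pos0 := lpos_ge0 x; have neg0 := lneg_ge0 x.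
have hp y : 0 <=l y -> y <=l labs x -> `|p y| <= c * `|x|.
  move=> y0 yx; rewrite ger0_norm ?p0// (le_trans (pc _ y0))// ler_wpM2l//.
  by rewrite -(norm_labs x) ler0_norm_le.
rewrite mulrDl (le_trans (ler_normB _ _))// lerD//.
  by apply: hp; rewrite // lpos_le_labs.
by apply: hp; rewrite // lneg_le_labs.
Qed.

Definition dpos_set f x : set R :=
  [set f y | y in [set y | 0 <=l y /\ y <=l x]].

Definition dpos_fun f x : R := sup (dpos_set f x).

Lemma dpos_ub f x y : 0 <=l y -> y <=l x -> f y <= `|f| * `|x| :> R.
Proof.
move=> y0 yx; rewrite (le_trans (ler_norm _))// (le_trans (ler_dual _ _))//.
by rewrite ler_wpM2l// ler0_norm_le.
Qed.

Lemma dpos_has_ubound f x : has_ubound (dpos_set f x).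
Proof.
by exists (`|f| * `|x|) => _ [y [y0 yx] <-]; exact: dpos_ub.
Qed.

Lemma le_dpos f x y : 0 <=l y -> y <=l x -> f y <= dpos_fun f x :> R.
Proof.
move=> y0 yx; apply: ub_le_sup; first exact: dpos_has_ubound.
by exists y.
Qed.

Lemma dpos_le f x (c : R) : 0 <=l x ->
  (forall y, 0 <=l y -> y <=l x -> f y <= c :> R) -> dpos_fun f x <= c.
Proof.
move=> x0 fc; apply: ge_sup; first by exists (f 0 : R), 0.
by move=> _ [y [y0 yx] <-]; exact: fc.
Qed.

Lemma dpos_ge0 f x : 0 <=l x -> 0 <= dpos_fun f x.
Proof. by move=> x0; rewrite -(linear0 f) le_dpos. Qed.

Lemma dposD f x y : 0 <=l x -> 0 <=l y ->
  dpos_fun f (x + y) = dpos_fun f x + dpos_fun f y.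
Proof.
move=> x0 y0; apply/le_anti/andP; split.
  apply: dpos_le; first exact: laddr_ge0.
  move=> z z0 /(riesz_decomp x0 y0 z0)[z1 [z2 [-> z10 z1x z20 z2y]]].
  by rewrite linearD lerD// le_dpos.
rewrite -lerBrDr; apply: dpos_le => // u u0 ux.
rewrite lerBrDr addrC -lerBrDr; apply: dpos_le => // v v0 vy.
rewrite lerBrDr addrC -linearD; apply: le_dpos; first exact: laddr_ge0.
exact: lleD.
Qed.

Lemma dposZ_ge f (a : R) x : 0 <= a -> 0 <=l x ->
  dpos_fun f (a *: x) >= a * dpos_fun f x.
Proof.
move=> + x0; rewrite [0 <= a]le_eqVlt => /predU1P[<-|a0].
  by rewrite mul0r scale0r dpos_ge0.
rewrite -ler_pdivlMl//; apply: dpos_le => // y y0 yx.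
rewrite ler_pdivlMl//; have -> : a * f y = f (a *: y) by rewrite linearZ.
by apply: le_dpos; [rewrite lscale_ge0// ltW|rewrite lleZ2l// ltW].
Qed.

Lemma dposZ f (a : R) x : 0 <= a -> 0 <=l x ->
  dpos_fun f (a *: x) = a * dpos_fun f x.
Proof.
move=> a0 x0; apply/le_anti; rewrite dposZ_ge// andbT.
move: a0; rewrite [0 <= a]le_eqVlt => /predU1P[<-|a0].
  rewrite mul0r scale0r; apply: dpos_le => // y y0 yle0.
  by rewrite (@lle_anti _ _ y 0) ?yle0 ?y0// linear0.
rewrite -ler_pdivrMl//.
have := @dposZ_ge f a^-1 (a *: x).
by rewrite scalerA mulVf ?gt_eqF// scale1r; apply;
  rewrite ?invr_ge0 ?lscale_ge0// ltW.
Qed.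

Lemma dpos_bounded f :
  (fun x => dpos_fun f (lpos x) - dpos_fun f (lneg x)) \in bounded_op E R^o.
Proof.
apply: (@dual_extend _ `|f|) => //; first exact: dposD.
- exact: dposZ.
- exact: dpos_ge0.
- by move=> x x0; apply: dpos_le => // y; exact: dpos_ub.
Qed.

Definition dpos f : dual E := Bop (dpos_bounded f).

Lemma dposE f x : 0 <=l x -> dpos f x = dpos_fun f x.
Proof.
move=> x0; rewrite /dpos/=.
have -> : lpos x = x by apply/lle_anti; rewrite lle_joinl x0 lle_refl le_lpos.
suff -> : lneg x = 0.
  have := dposZ f (lexx (0 : R)) (lle_refl (0 : E)).
  by rewrite scale0r mul0r => ->; rewrite subr0.
by apply/lle_anti; rewrite lneg_ge0 andbT lle_joinl loppr_le0 x0/=.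
Qed.

(* [f <= g] iff [f x <= g x] for all [x >= 0]; the supremum of [f] and [g] is
   [g + (f - g)^+], with [(f - g)^+] given on the positive cone by the
   Riesz-Kantorovich formula. *)
Definition dle f g : bool := `[< forall x, 0 <=l x -> f x <= g x :> R >].
Definition djoin f g : dual E := g + dpos (f - g).
Arguments djoin : simpl never.
Definition dmeet f g : dual E := - djoin (- f) (- g).

Lemma dle_refl : reflexive dle.
Proof. by move=> f; apply/asboolP. Qed.

Lemma dle_trans : transitive dle.
Proof.
move=> g f h /asboolP fg /asboolP gh; apply/asboolP => x x0.
exact: le_trans (fg _ x0) (gh _ x0).
Qed.

Lemma dle_anti : antisymmetric dle.
Proof.
move=> f g /andP[/asboolP fg /asboolP gf]; apply: dual_ext => x.
have fgE y : 0 <=l y -> f y = g y by move=> y0; apply/le_anti; rewrite fg ?gf.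
by rewrite [x]lpos_lneg !linearB/= !fgE ?lpos_ge0 ?lneg_ge0.
Qed.

Lemma dleN2 f g : dle (- f) (- g) = dle g f.
Proof.
by apply/asboolP/asboolP => h x /h; rewrite !dualNE lerN2.
Qed.

Lemma dle_joinl f g h : dle (djoin f g) h = dle f h && dle g h.
Proof.
apply/asboolP/andP => [fgh|[/asboolP fh /asboolP gh] x x0].
  split; apply/asboolP => x x0; apply: le_trans (fgh _ x0);
    rewrite dualDE dposE//.
    by rewrite -lerBlDl -[leLHS]/((f - g) x) le_dpos.
  by rewrite lerDl dpos_ge0.
rewrite dualDE dposE// -lerBrDl; apply: dpos_le => // y y0 yx.
rewrite -[leLHS]/(f y - g y) lerBlDr.
have xy0 : 0 <=l x - y by rewrite lsubr_ge0.
have := gh _ xy0; rewrite !linearB/= => gxy.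
have := fh _ y0; lra.
Qed.

Lemma dle_meetr f g h : dle h (dmeet f g) = dle h f && dle h g.
Proof. by rewrite -dleN2 opprK dle_joinl !dleN2. Qed.

Lemma dleD2r h f g : dle f g -> dle (f + h) (g + h).
Proof. by move=> /asboolP fg; apply/asboolP => x x0; rewrite !dualDE lerD2r fg. Qed.

Lemma dscale_ge0 (a : R) f : 0 <= a -> dle 0 f -> dle 0 (a *: f).
Proof.
move=> a0 /asboolP f0; apply/asboolP => x x0.
by apply: mulr_ge0 => //; exact: f0.
Qed.

Lemma dle_djoin f g : dle f (djoin f g).
Proof. by have := dle_joinl f g (djoin f g); rewrite dle_refl => /esym/andP[]. Qed.

Lemma dle_djoinr f g : dle g (djoin f g).
Proof. by have := dle_joinl f g (djoin f g); rewrite dle_refl => /esym/andP[]. Qed.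

Lemma dnorm_le f g : dle (djoin f (- f)) (djoin g (- g)) -> `|f| <= `|g|.
Proof.
move=> /asboolP fg; apply: dual_norm_le => // x.
have h1 : `|f x| <= djoin f (- f) (labs x).
  rewrite labs_lpos_lneg linearD/= {1}[x]lpos_lneg linearB/=.
  have p0 := lpos_ge0 x; have n0 := lneg_ge0 x.
  have /asboolP J1 := dle_djoin f (- f).
  have /asboolP J2 := dle_djoinr f (- f).
  have := J1 _ p0; have := J1 _ n0; have := J2 _ p0; have := J2 _ n0.
  rewrite !dualNE => p2 n2 p1 n1; rewrite ler_norml; apply/andP; split.
    by rewrite opprD lerD// ?lerN2// lerNl.
  by rewrite lerD.
rewrite (le_trans h1)// (le_trans (fg _ (labs_ge0 x)))// -(norm_labs x).
have z0 := labs_ge0 x; move: (labs x) z0 => z z0.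
rewrite dualDE dposE// opprK -lerBrDl; apply: dpos_le => // y y0 yz.
rewrite lerBrDl dualNE dualDE -linearN -!linearD/=.
rewrite (le_trans (ler_norm _))// (le_trans (ler_dual _ _))// ler_wpM2l//.
apply: labs_norm_le; rewrite (ger0_labs z0) labs_le.
rewrite [- z + _]addrC lle_subl lleD//= opprD opprK addrC lle_subl.
by rewrite -lsubr_ge0 addrC addrA addNr add0r laddr_ge0.
Qed.

HB.instance Definition _ := isBanachLattice.Build R (dual E)
  dle_refl dle_anti dle_trans dle_joinl dle_meetr dleD2r dscale_ge0 dnorm_le.

End DualLattice.

Section RegularOperators.
Context {R : realType} {X Y : banachLatticeType R}.
Implicit Types S T A B : bop X Y.

(* Positive linear maps between Banach lattices are automatically bounded, so
   restricting to [bop X Y] loses nothing. *)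
Definition positive_op T : Prop := forall x, 0 <=l x -> 0 <=l T x.

Definition regular_op : {pred bop X Y} :=
  [pred T | `[< exists A B, [/\ positive_op A, positive_op B & T = A - B] >]].

Definition dominates S T : Prop := forall x, labs (T x) <=l S (labs x).

Lemma positive_opD A B : positive_op A -> positive_op B -> positive_op (A + B).
Proof. by move=> A0 B0 x x0; rewrite bop_addE laddr_ge0 ?A0 ?B0. Qed.

Lemma positive_opZ (a : R) A : 0 <= a -> positive_op A -> positive_op (a *: A).
Proof. by move=> a0 A0 x x0; rewrite bop_scaleE lscale_ge0 ?A0. Qed.

Lemma positive_op0 : positive_op 0.
Proof. by []. Qed.

Lemma positive_op_le A x y : positive_op A -> x <=l y -> A x <=l A y.
Proof.
by move=> A0 xy; rewrite -lsubr_ge0 -linearB; apply: A0; rewrite lsubr_ge0.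
Qed.

Lemma positive_op_dominates A : positive_op A -> dominates A A.
Proof.
move=> A0 x; rewrite labs_le -linearN.
by rewrite !positive_op_le ?le_labs ?leN_labs.
Qed.

Lemma dominatesD S T S' T' :
  dominates S T -> dominates S' T' -> dominates (S + S') (T + T').
Proof.
move=> ST ST' x; rewrite !bop_addE; apply: lle_trans (labsD _ _) _.
exact: lleD.
Qed.

Lemma dominatesZ (a : R) S T : dominates S T -> dominates (`|a| *: S) (a *: T).
Proof.
move=> ST x; rewrite !bop_scaleE; apply: lle_trans (labsZ_le _ _) _.
exact: lleZ2l.
Qed.

Lemma dominatesN S T : dominates S T -> dominates S (- T).
Proof. by move=> ST x; rewrite bop_oppE labsN. Qed.

Lemma dominates_norm S T : dominates S T -> `|T| <= `|S|.
Proof.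
move=> ST; rewrite {1}bop_normE opnorm_le// => x.
rewrite -[leLHS]norm_labs (le_trans (ler0_norm_le (labs_ge0 _) (ST x)))//.
by rewrite (le_trans (ler_opnorm _ _))// norm_labs.
Qed.

Lemma regular_opP T :
  T \in regular_op <-> exists2 S, positive_op S & dominates S T.
Proof.
split=> [/asboolP[A [B [A0 B0 ->]]]|[S S0 ST]].
  exists (A + B); first exact: positive_opD.
  by apply: dominatesD; rewrite ?dominatesN//; first exact: positive_op_dominates;
    apply/dominatesN/positive_op_dominates.
apply/asboolP; exists S, (S - T); split=> //; last by rewrite opprB addrC subrK.
move=> x x0; rewrite bop_subE lsubr_ge0.
by rewrite (lle_trans (le_labs _))// (lle_trans (ST x))// ger0_labs.
Qed.

Lemma regular_op_submod : submod_closed regular_op.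
Proof.
split; first by apply/regular_opP; exists 0 => // x; rewrite labs0.
move=> a T T' /regular_opP[S S0 ST] /regular_opP[S' S'0 ST'].
apply/regular_opP; exists (`|a| *: S + S').
  by apply: positive_opD => //; apply: positive_opZ.
by apply: dominatesD => //; exact: dominatesZ.
Qed.

End RegularOperators.
Arguments regular_op {R} X Y.

(* Differences of positive operators, with the regular norm [rnorm] instead of
   the operator norm. *)
Record rop (R : realType) (X Y : banachLatticeType R) : Type :=
  Rop { rop_bop :> bop X Y ; _ : rop_bop \in regular_op X Y }.

Section RegularNorm.
Context {R : realType} {X Y : banachLatticeType R}.

HB.instance Definition _ := [isSub for @rop_bop R X Y].
HB.instance Definition _ := [Choice of rop X Y by <:].
HB.instance Definition _ :=
  GRing.SubChoice_isSubLmodule.Build R _ _ (rop X Y)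
    (@regular_op_submod R X Y).

Implicit Types T : rop X Y.

Definition rnorm_set T : set R :=
  [set `|S| | S in [set S : bop X Y | positive_op S /\ dominates S T]].

Definition rnorm T : R := inf (rnorm_set T).

Lemma rop_bopD T T' : rop_bop (T + T') = rop_bop T + rop_bop T'.
Proof. by []. Qed.

Lemma rop_bopB T T' : rop_bop (T - T') = rop_bop T - rop_bop T'.
Proof. by []. Qed.

Lemma rop_bopZ (a : R) T : rop_bop (a *: T) = a *: rop_bop T.
Proof. by []. Qed.

Lemma rnorm_set_neq0 T : rnorm_set T !=set0.
Proof.
have /regular_opP[S S0 ST] := valP T.
by exists `|S|, S.
Qed.

Lemma rnorm_set_lb T : has_lbound (rnorm_set T).
Proof. by exists 0 => _ [S _ <-]. Qed.

Lemma rnorm_le T (S : bop X Y) : positive_op S -> dominates S T -> rnorm T <= `|S|.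
Proof.
by move=> S0 ST; apply: ge_inf; [exact: rnorm_set_lb|exists S].
Qed.

Lemma rnorm_lt T (e : R) : rnorm T < e ->
  exists S : bop X Y, [/\ positive_op S, dominates S T & `|S| < e].
Proof.
move=> Te; have e0 : 0 < e - rnorm T by rewrite subr_gt0.
have [_ [S [S0 ST] <-]] :=
  inf_adherent e0 (conj (rnorm_set_neq0 T) (rnorm_set_lb T)).
by rewrite addrC subrK => Se; exists S.
Qed.

Lemma opnorm_rnorm T : `|rop_bop T| <= rnorm T.
Proof.
apply: lb_le_inf; first exact: rnorm_set_neq0.
by move=> _ [S [S0 ST] <-]; exact: dominates_norm.
Qed.

Lemma ler_rnormD T T' : rnorm (T + T') <= rnorm T + rnorm T'.
Proof.
apply/ler_addgt0Pr => e e0.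
have e20 : 0 < e / 2 by rewrite divr_gt0.
have [S [S0 ST Se]] := @rnorm_lt T (rnorm T + e / 2) (ltr_pwDr e20 (lexx _)).
have [S' [S'0 ST' Se']] :=
  @rnorm_lt T' (rnorm T' + e / 2) (ltr_pwDr e20 (lexx _)).
rewrite (@le_trans _ _ `|S + S'|)//.
  by apply: rnorm_le; [exact: positive_opD|exact: dominatesD].
rewrite (le_trans (ler_normD _ _))// [e]splitr addrACA.
by rewrite lerD// ltW.
Qed.

Lemma rnormZ_le (a : R) T : rnorm (a *: T) <= `|a| * rnorm T.
Proof.
have [->|a0] := eqVneq a 0.
  rewrite scale0r normr0 mul0r -(@normr0 _ (bop X Y)) rnorm_le//.
  by move=> x; rewrite labs0.
rewrite -ler_pdivrMl ?normr_gt0//; apply: lb_le_inf.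
  exact: rnorm_set_neq0.
move=> _ [S [S0 ST] <-]; rewrite ler_pdivrMl ?normr_gt0//.
have -> : `|a| * `|S| = `| `|a| *: S | by rewrite normrZ normr_id.
by apply: rnorm_le; [exact: positive_opZ|exact: dominatesZ].
Qed.

Lemma rnorm_ge0 T : 0 <= rnorm T.
Proof. exact: le_trans (opnorm_rnorm T). Qed.

Lemma rnormZ (a : R) T : rnorm (a *: T) = `|a| * rnorm T.
Proof.
have [->|a0] := eqVneq a 0.
  apply/le_anti; rewrite rnormZ_le/= normr0 mul0r; exact: rnorm_ge0.
apply/le_anti; rewrite rnormZ_le/=.
have := rnormZ_le a^-1 (a *: T); rewrite scalerA mulVf// scale1r.
by rewrite normfV ler_pdivlMl ?normr_gt0.
Qed.

Lemma rnorm_eq0 T : rnorm T = 0 -> T = 0.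
Proof.
move=> T0; apply/val_inj/eqP; rewrite -normr_le0 -T0.
exact: opnorm_rnorm.
Qed.

HB.instance Definition _ := Lmodule_isNormed.Build R (rop X Y)
  ler_rnormD rnormZ rnorm_eq0.

Lemma lcone_closed (y : Y) :
  (forall e : R, 0 < e -> exists2 z, 0 <=l z & `|z - y| <= e) -> 0 <=l y.
Proof.
move=> h; suff n0 : lneg y = 0.
  by rewrite [y]lpos_lneg n0 subr0 lpos_ge0.
apply/eqP; rewrite -normr_le0; apply/ler_addgt0Pr => e e0; rewrite add0r.
have [z z0 zy] := h _ e0; rewrite (le_trans _ zy)// labs_norm_le//.
rewrite ger0_labs ?lneg_ge0// lle_joinl labs_ge0 andbT.
rewrite (lle_trans _ (le_labs _))// -lsubr_ge0.
by rewrite opprK subrK.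
Qed.

Lemma rop_complete (F : set_system (rop X Y)) :
  ProperFilter F -> cauchy F -> cvg F.
Proof.
move=> FF Fc; pose d (n : nat) : R := 2^-1 ^+ n.
have d0 n : 0 < d n by rewrite exprn_gt0// invr_gt0.
have dcvg : cvgn (series d).
  have -> : d = geometric 1 2^-1 by apply/funext => n; rewrite /geometric/= mul1r.
  apply: is_cvg_geometric_series; rewrite ger0_norm ?invr_ge0//.
  by rewrite invf_lt1// ltr1n.
have /choice[A AP] n : exists A : set (rop X Y),
    F A /\ forall T T', A T -> A T' -> rnorm (T - T') < d n.
  have := Fc; rewrite -cauchy_ballP => /(_ _ (d0 n))[[A B]/= [FA FB]] AB.
  exists (A `&` B); split; first exact: filterI.
  move=> T T' [AT _] [_ BT']; have := AB (T, T') (conj AT BT').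
  by rewrite -ball_normE.
have /choice[t tP] n : exists T, A n T /\ A n.-1 T.
  exact: (@filter_ex _ F _ _ (filterI (AP n).1 (AP n.-1).1)).
have /choice[s sP] n : exists S : bop X Y,
    [/\ positive_op S, dominates S (t n.+1 - t n) & `|S| < d n].
  apply: rnorm_lt; apply: (AP n).2; first exact: (tP n.+1).2.
  exact: (tP n).1.
have scvg : cvgn (series s).
  apply: normed_cvg; apply: series_le_cvg dcvg => n //=; first exact: ltW.
  by have [_ _ /ltW] := sP n.
pose D n : bop X Y := rop_bop (t n.+1) - rop_bop (t n).
have Dcvg : cvgn (series D).
  apply: normed_cvg; apply: series_le_cvg dcvg => n //=; first exact: ltW.
  have [_ st /ltW] := sP n; apply: le_trans.
  exact: dominates_norm.
have DE n : series D n = rop_bop (t n) - rop_bop (t 0%N).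
  exact: (congr1 (fun f => f n) (telescopeK (fun n => rop_bop (t n)))).
pose S := limn (series s).
pose T : bop X Y := limn (series D) + rop_bop (t 0%N).
have mono n m : (n <= m)%N -> positive_op (series s m - series s n) /\
    dominates (series s m - series s n) (rop_bop (t m) - rop_bop (t n)).
  elim: m => [|m IH]; first by rewrite leqn0 => /eqP ->; rewrite !subrr; split
    => // x; rewrite labs0.
  rewrite leq_eqVlt => /predU1P[->|]; first by rewrite !subrr; split
    => // x; rewrite labs0.
  rewrite ltnS => /IH[p q]; rewrite seriesEnat/= big_nat_recr//=.
  have [s0 st _] := sP m.
  have -> : forall a b c : bop X Y, a + b - c = b + (a - c).
    by move=> a b c; rewrite addrAC addrC.
  have -> : rop_bop (t m.+1) - rop_bop (t n) =
     (rop_bop (t m.+1) - rop_bop (t m)) + (rop_bop (t m) - rop_bop (t n)).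
    by rewrite addrA subrK.
  by split; [exact: positive_opD|exact: dominatesD].
have near_s (e : R) : 0 < e -> exists N, forall m, (N <= m)%N ->
    `|S - series s m| <= e.
  move=> e0; have /cvgrPdist_le /(_ _ e0) [N _ Ne] := scvg.
  by exists N => m; exact: Ne.
have near_t (e : R) : 0 < e -> exists N, forall m, (N <= m)%N ->
    `|T - rop_bop (t m)| <= e.
  move=> e0; have /cvgrPdist_le /(_ _ e0) [N _ Ne] := Dcvg.
  by exists N => m /Ne /=; rewrite DE /T opprB addrA.
have ev (U : bop X Y) x (e : R) : `|U| <= e / (`|x| + 1) -> 0 < e ->  `|U x| <= e.
  move=> Ue e0; rewrite (le_trans (ler_opnorm U x))//.
  rewrite (le_trans (ler_wpM2r (normr_ge0 x) Ue))// mulrAC ler_pdivrMr ?ltr_wpDl//.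
  by rewrite ler_pM2l// lerDl.
have dx (x : X) (e : R) : 0 < e -> 0 < e / (`|x| + 1).
  by move=> e0; rewrite divr_gt0// ltr_wpDl.
have Spos n : positive_op (S - series s n).
  move=> x x0; apply: lcone_closed => e e0.
  have [N Ne] := near_s _ (dx x _ e0).
  exists ((series s (maxn N n) - series s n) x).
    by apply: (mono n _ (leq_maxr _ _)).1.
  rewrite -bop_subE opprB addrA subrK -normrN -bop_oppE opprB.
  by apply: ev => //; apply: Ne; exact: leq_maxl.
have dom_lim n (x : X) z : (forall m, (n <= m)%N -> (rop_bop (t m) - rop_bop (t n)) x <=l z) ->
    (T - rop_bop (t n)) x <=l z.
  move=> h; rewrite -lsubr_ge0; apply: lcone_closed => e e0.
  have [N Ne] := near_t _ (dx x _ e0).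
  exists (z - (rop_bop (t (maxn N n)) - rop_bop (t n)) x).
    by rewrite lsubr_ge0 h// leq_maxr.
  have -> : forall a b c : Y, a - b - (a - c) = c - b.
    by move=> a b c; rewrite opprB addrC addrA subrK.
  rewrite -bop_subE opprB addrA subrK.
  by apply: ev => //; apply: Ne; exact: leq_maxl.
have dom n : dominates (S - series s n) (T - rop_bop (t n)).
  have hm m x : (n <= m)%N ->
      labs ((rop_bop (t m) - rop_bop (t n)) x) <=l (S - series s n) (labs x).
    move=> nm; apply: lle_trans ((mono _ _ nm).2 x) _.
    rewrite -lsubr_ge0 -bop_subE opprB addrA subrK; apply: Spos.
    exact: labs_ge0.
  move=> x; rewrite labs_le; apply/andP; split.
    apply: dom_lim => m /(hm m x); exact: lle_trans (le_labs _).
  rewrite -linearN -labsN; apply: dom_lim => m /(hm m (- x)).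
  exact: lle_trans (le_labs _).
have Treg : T \in regular_op X Y.
  have h : T - rop_bop (t 0%N) \in regular_op X Y.
    by apply/regular_opP; exists (S - series s 0%N).
  have [_ /(_ 1 _ _ h (valP (t 0%N)))] := @regular_op_submod R X Y.
  by rewrite scale1r subrK.
apply/cvg_ex; exists (Rop Treg); apply/cvgrPdist_le => e e0.
have e20 : 0 < e / 2 by rewrite divr_gt0.
have [N1 N1e] := near_s _ e20.
have [N2 N2e] : exists N, forall m, (N <= m)%N -> d m <= e / 2.
  have /cvgrPdist_le /(_ _ e20) [N _ Ne] := cvg_series_cvg_0 dcvg.
  by exists N => m /Ne /=; rewrite sub0r normrN ger0_norm// ltW.
pose n := maxn N1 N2.
apply: (@filterS _ F _ (A n)); last exact: (AP n).1.
move=> U AU /=.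
have -> : Rop Treg - U = (Rop Treg - t n) + (t n - U) by rewrite addrA subrK.
rewrite (le_trans (ler_normD _ _))// [e]splitr lerD//.
  apply: (@le_trans _ _ `|S - series s n|); last exact: N1e (leq_maxl _ _).
  by apply: rnorm_le; [exact: Spos|exact: dom].
apply: (@le_trans _ _ (d n)); last exact: N2e (leq_maxr _ _).
by apply/ltW/(AP n).2 => //; exact: (tP n).1.
Qed.

HB.instance Definition _ := Uniform_isComplete.Build (rop X Y) rop_complete.

End RegularNorm.

Section RankOne.
Context {R : realType} {E F : banachLatticeType R}.

Definition elem_fun (x : E) (y : F) (f : dual E) : F := f x *: y.

Lemma elem_bounded x y : elem_fun x y \in bounded_op (dual E) F.
Proof.
apply: (@linear_bop _ _ _ _ (`|x| * `|y|)) => [a f g|f].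
  by rewrite /elem_fun scalerA -scalerDl.
by rewrite /elem_fun normrZ mulrAC ler_wpM2r// [leRHS]mulrC ler_dual.
Qed.

Definition elem_bop x y : bop (dual E) F := Bop (elem_bounded x y).

Lemma elem_positive x y : 0 <=l x -> 0 <=l y -> positive_op (elem_bop x y).
Proof.
move=> x0 y0 f /asboolP f0; rewrite /elem_bop/= /elem_fun lscale_ge0//.
exact: f0.
Qed.

Lemma elem_regular x y : elem_bop x y \in regular_op (dual E) F.
Proof.
apply/asboolP; exists (elem_bop (lpos x) (lpos y) + elem_bop (lneg x) (lneg y)),
  (elem_bop (lpos x) (lneg y) + elem_bop (lneg x) (lpos y)); split.
- by apply: positive_opD; apply: elem_positive; rewrite ?lpos_ge0 ?lneg_ge0.
- by apply: positive_opD; apply: elem_positive; rewrite ?lpos_ge0 ?lneg_ge0.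
apply: bop_ext => f; rewrite bop_subE !bop_addE /elem_bop/= /elem_fun.
have fx : f x = (f (lpos x) : R) - f (lneg x).
  by rewrite {1}[x]lpos_lneg linearB.
rewrite fx {1}[y]lpos_lneg scalerBl !scalerBr opprB.
by rewrite opprD [LHS]addrACA.
Qed.

Definition elem_tensor x y : rop (dual E) F := Rop (elem_regular x y).

(* The operator [T_u] for [u] a finite sum of elementary tensors, represented
   by a list of pairs.  The map from the algebraic tensor product to
   operators is injective as [dual E] separates the points of [E]. *)
Definition tensor_op (u : seq (E * F)) : rop (dual E) F :=
  \sum_(p <- u) elem_tensor p.1 p.2.

Lemma tensor_opE u (f : dual E) : tensor_op u f = \sum_(p <- u) f p.1 *: p.2.
Proof.
rewrite /tensor_op; elim: u => [|p u IH]; first by rewrite !big_nil.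
by rewrite !big_cons rop_bopD bop_addE IH.
Qed.

Lemma tensor_op_cat u v : tensor_op (u ++ v) = tensor_op u + tensor_op v.
Proof. by rewrite /tensor_op big_cat. Qed.

Lemma tensor_opZ (a : R) u :
  tensor_op [seq (a *: p.1, p.2) | p <- u] = a *: tensor_op u.
Proof.
rewrite /tensor_op big_map scaler_sumr; apply: eq_bigr => p _ /=.
apply/val_inj/bop_ext => f.
by rewrite -[RHS]/(a *: (f p.1 *: p.2)) /= /elem_fun linearZ/= scalerA.
Qed.

Definition wtensor_op : {pred rop (dual E) F} :=
  [pred T | `[< closure (range tensor_op) T >]].

Lemma wtensor_opP (T : rop (dual E) F) : T \in wtensor_op <->
  forall e : R, 0 < e -> exists u, `|T - tensor_op u| < e.
Proof.
split=> [/asboolP cT e e0|h].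
  have [_ [[u _ <-]]] := cT _ (nbhsx_ballx T e e0).
  by rewrite -ball_normE/= => Tu; exists u.
apply/asboolP => B /nbhs_ballP[e /= e0 eB].
have [u Tu] := h _ e0; exists (tensor_op u); split; first by exists u.
by apply: eB; rewrite -ball_normE.
Qed.

Lemma wtensor_op_submod : submod_closed wtensor_op.
Proof.
split; first by apply/wtensor_opP => e e0; exists [::];
  rewrite /tensor_op big_nil subrr normr0.
move=> a S T /wtensor_opP Sc /wtensor_opP Tc; apply/wtensor_opP => e e0.
have a1 : 0 < `|a| + 1 by rewrite ltr_wpDl.
have [u Su] := Sc (e / 2 / (`|a| + 1)) ltac:(by rewrite !divr_gt0).
have [v Tv] := Tc (e / 2) ltac:(by rewrite divr_gt0).
exists ([seq (a *: p.1, p.2) | p <- u] ++ v).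
rewrite tensor_op_cat tensor_opZ opprD addrACA -scalerBr.
rewrite (le_lt_trans (ler_normD _ _))// [e]splitr ler_ltD// normrZ.
rewrite (le_trans (ler_wpM2l (normr_ge0 a) (ltW Su)))//.
rewrite mulrCA ler_piMr ?divr_ge0 ?(ltW e0)//.
by rewrite ler_pdivrMr// mul1r lerDl.
Qed.

End RankOne.
Arguments wtensor_op {R} E F.

(* The completion of [E \otimes F] in the Wittstock norm, realized as the
   closure of the operators [T_u] in the Banach space [rop (dual E) F]; it
   carries the regular norm. *)
Record wtensor (R : realType) (E F : banachLatticeType R) : Type :=
  WTensor { wtensor_rop :> rop (dual E) F ;
            _ : wtensor_rop \in wtensor_op E F }.

Section WittstockTensor.
Context {R : realType} {E F : banachLatticeType R}.

HB.instance Definition _ := [isSub for @wtensor_rop R E F].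
HB.instance Definition _ := [Choice of wtensor E F by <:].
HB.instance Definition _ :=
  GRing.SubChoice_isSubLmodule.Build R _ _ (wtensor E F)
    (@wtensor_op_submod R E F).

Definition wnorm (T : wtensor E F) : R := `|wtensor_rop T|.

Lemma ler_wnormD S T : wnorm (S + T) <= wnorm S + wnorm T.
Proof. exact: ler_normD. Qed.

Lemma wnormZ (a : R) T : wnorm (a *: T) = `|a| * wnorm T.
Proof. exact: (normrZ a (wtensor_rop T)). Qed.

Lemma wnorm_eq0 T : wnorm T = 0 -> T = 0.
Proof. by move=> /normr0_eq0 T0; apply/val_inj. Qed.

HB.instance Definition _ := Lmodule_isNormed.Build R (wtensor E F)
  ler_wnormD wnormZ wnorm_eq0.

Lemma wtensor_complete (G : set_system (wtensor E F)) :
  ProperFilter G -> cauchy G -> cvg G.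
Proof.
move=> FG Gc; have : cvg (@wtensor_rop R E F @ G).
  apply: cauchy_cvg; apply/cauchy_ballP => e e0.
  have := Gc; rewrite -cauchy_ballP => /(_ _ e0)[[A B]/= [GA GB]] AB.
  exists (@wtensor_rop R E F @` A, @wtensor_rop R E F @` B) => /=.
    split; first by apply: (@filterS _ G _ A) => // T AT; exists T.
    by apply: (@filterS _ G _ B) => // T BT; exists T.
  move=> [_ _] [[S AS <-] [T BT <-]] /=.
  by have := AB (S, T) (conj AS BT); rewrite -!ball_normE.
move=> /cvg_ex[T GT].
have Tw : T \in wtensor_op E F.
  apply/asboolP; apply: (closed_cvg _ (@closed_closure _ _) _ _ GT).
  by near=> S; have /asboolP := valP S.
apply/cvg_ex; exists (WTensor Tw); apply/cvgrPdist_le => e e0.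
by move/cvgrPdist_le : GT => /(_ _ e0).
Unshelve. all: by end_near. Qed.

HB.instance Definition _ :=
  Uniform_isComplete.Build (wtensor E F) wtensor_complete.

End WittstockTensor.

Section Properties.
Context {R : realType}.

Definition finite_dimensional (V : lmodType R) (A : set V) : Prop :=
  exists (n : nat) (v : 'I_n -> V),
    forall x, A x -> exists c : 'I_n -> R, x = \sum_(i < n) c i *: v i.

Definition infinite_dimensional (V : lmodType R) : Prop :=
  ~ finite_dimensional [set: V].

Definition finite_rank (X Y : normedModType R) (T : bop X Y) : Prop :=
  finite_dimensional (range T).

Definition reflexive_space (X : normedModType R) : Prop :=
  forall phi : dual (dual X), exists x : X, forall f : dual X, phi f = f x.

Definition weak_star_null (X : normedModType R) (f : nat -> dual X) : Prop :=
  forall x : X, (fun n => f n x : R) @ \oo --> (0 : R).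

Definition weakly_null (X : normedModType R) (x : nat -> X) : Prop :=
  forall f : dual X, (fun n => f (x n) : R) @ \oo --> (0 : R).

Definition grothendieck (X : completeNormedModType R) : Prop :=
  forall f : nat -> dual X, weak_star_null f -> weakly_null f.

Definition bpap (X : banachLatticeType R) : Prop :=
  exists2 lambda : R, 1 <= lambda &
    forall (C : set X) (e : R), compact C -> 0 < e ->
      exists T : bop X X, [/\ finite_rank T, positive_op T, `|T| <= lambda &
        forall x, C x -> `|x - T x| <= e].

End Properties.

(* Main.v *)
Require Import Defs.
From HB Require Import structures.
From mathcomp Require Import all_boot all_order all_algebra.
From mathcomp Require Import boolp classical_sets functions reals.
From mathcomp Require Import topology normedtype sequences.
From mathcomp Require Import interval_inference.
From mathcomp Require Import ring lra.

(** Write [W] for the Wittstock tensor product of [E] and [F].  The first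
    alternative is what holds: if [W] is a Grothendieck space, then [E] is
    reflexive.  Reflexivity is obtained from the classical criterion that [E]
    and its dual are both KB-spaces (increasing norm bounded sequences of
    positive vectors converge), [kb_reflexive].

    Both KB properties come from the same mechanism, [not_grothendieck].
    Suppose that functionals [psi n] on [W] are weak-star null and that a
    bounded sequence [u k] of [W] satisfies [d <= psi n (u k)] whenever
    [n <= k].  An ultrafilter limit of the evaluations at the [u k] is an
    element of the bidual that is at least [d] on every [psi n], so that
    [psi] is not weakly null.

    - The dual of [E] is KB ([grothendieck_kb_dual]).  An increasing bounded
      sequence [s n] of functionals has a pointwise limit [H].  If it is not
      norm convergent, take [psi n = (H - s n) (x) h] and
      [u k = x k (x) y], where [x k] nearly norms [s k.+1 - s k].

    - [E] is KB ([grothendieck_kb]).  Otherwise the increments of an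
      increasing bounded sequence are positive vectors [x k] with bounded
      partial sums and norms bounded below; Rosenthal's lemma makes them
      almost biorthogonal to positive functionals [f k] of norm at most one
      ([not_kb_biorthogonal]).  On the infinite dimensional lattice [F] there
      are finite families of norm one functionals [h i] whose moduli are small
      in the mean at every point of the unit ball ([spread_functionals]).
      Let [psi n] be the average over [i] of [f i (x) h i], the [n]th family
      being used for the [n]th block of indices.  It is weak-star null
      because of the smallness in the mean, and it is bounded below on
      [sum_k x k (x) v k], with [v k] nearly norming [h k]; these sums are
      bounded in the Wittstock norm because the [x k] are positive with
      bounded sums.

    For the criterion, let [phi] be positive in the bidual and let [m] be a
    maximal vector of [E] below [phi].  If [phi - m] is not zero, then
    [kb_bidual_minorant] finds a nonzero positive vector of [E] below it,
    which contradicts maximality.  That lemma plays Hahn decompositions in [E]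
    against Hahn decompositions in the dual; the KB property provides them
    through a Borel-Cantelli argument ([kb_disjoint_split]). *)

Set Implicit Arguments.
Unset Strict Implicit.
Unset Printing Implicit Defensive.

Import Order.TTheory GRing.Theory Num.Theory.
Import numFieldNormedType.Exports.

Local Open Scope classical_set_scope.
Local Open Scope ring_scope.

(** * The Hahn-Banach theorem *)

Section HahnBanach.
Context {R : realType}.

Record sublinear (X : lmodType R) (p : X -> R) : Prop := Sublinear {
  subl_add : forall x y, p (x + y) <= p x + p y ;
  subl_pos : forall (a : R) x, 0 <= a -> p (a *: x) <= a * p x }.

Lemma subl0 (X : lmodType R) (p : X -> R) : sublinear p -> p 0 = 0.
Proof.
move=> [pD pZ]; apply/le_anti/andP; split.
  by have := pZ 0 0 (lexx _); rewrite scale0r mul0r.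
by have := pD 0 0; rewrite addr0; lra.
Qed.

Lemma subl_opp (X : lmodType R) (p : X -> R) x : sublinear p -> - p (- x) <= p x.
Proof.
by move=> sp; have := subl_add sp x (- x); rewrite subrr subl0//; lra.
Qed.

(** Lowering [p] along the ray of [y]: the result is still sublinear and takes
    at [- y] a value at most [- p y]. *)
Definition subl_shift (X : lmodType R) (p : X -> R) (y x : X) : R :=
  inf [set p (x + t *: y) - t * p y | t in [set t : R | 0 <= t]].

Lemma subl_shiftP (X : lmodType R) (p : X -> R) y : sublinear p ->
  [/\ sublinear (subl_shift p y), forall x, subl_shift p y x <= p x
    & forall x, subl_shift p y x <= p (x + y) - p y].
Proof.
move=> sp; have lb x t : 0 <= t -> - p (- x) <= p (x + t *: y) - t * p y.
  move=> t0; have := subl_add sp (x + t *: y) (- x).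
  rewrite addrAC subrr add0r => h1; have := subl_pos sp y t0.
  have := subl_add sp (t *: y + x) (- x).
  have : t * p y <= p (t *: y); last lra.
  have [->|tn0] := eqVneq t 0; first by rewrite mul0r scale0r subl0.
  have := @subl_pos _ _ sp t^-1 (t *: y); rewrite invr_ge0 t0 => /(_ isT).
  rewrite scalerA mulVf// scale1r => h.
  by rewrite -ler_pdivlMl// lt_neqAle eq_sym tn0.
have hlb x : has_lbound [set p (x + t *: y) - t * p y | t in [set t : R | 0 <= t]].
  by exists (- p (- x)) => _ [t /= t0 <-]; exact: lb.
have le x t : 0 <= t -> subl_shift p y x <= p (x + t *: y) - t * p y.
  by move=> t0; apply: ge_inf; [exact: hlb|exists t].
have ge x c : (forall t, 0 <= t -> c <= p (x + t *: y) - t * p y) ->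
    c <= subl_shift p y x.
  move=> h; apply: lb_le_inf; first by exists (p (x + 0 *: y) - 0 * p y), 0 => /=.
  by move=> _ [t /= t0 <-]; exact: h.
split; [split| |].
- move=> x z; rewrite -lerBlDr; apply: (ge _ _) => t t0.
  rewrite lerBlDr -lerBlDl; apply: (ge z) => s s0; rewrite lerBlDl.
  have ts0 : 0 <= t + s by rewrite addr_ge0.
  apply: le_trans (le _ _ ts0) _.
  have := subl_add sp (x + t *: y) (z + s *: y).
  by rewrite addrACA -scalerDl; lra.
- move=> a x a0; have [->|an0] := eqVneq a 0.
    rewrite mul0r scale0r; have := le 0 0 (lexx _).
    by rewrite scale0r addr0 (subl0 sp) mul0r subr0.
  have ap : 0 < a by rewrite lt_neqAle eq_sym an0.
  rewrite -ler_pdivrMl//; apply: (ge _ _) => t t0; rewrite ler_pdivrMl//.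
  have at0 : 0 <= a * t by rewrite mulr_ge0.
  apply: le_trans (le _ _ at0) _; rewrite -scalerA -scalerDr mulrBr mulrA.
  by rewrite lerD2r; exact: subl_pos.
- by move=> x; have := le x 0 (lexx _); rewrite scale0r addr0 mul0r subr0.
- by move=> x; have := le x 1 ler01; rewrite scale1r mul1r.
Qed.

(** By Zorn's lemma there is a minimal sublinear functional below [p].  By
    minimality it equals its lowering along every [y], and the inequality
    [subl_shift p y x <= p (x + y) - p y] then makes it additive. *)
Lemma hahn_banach (X : lmodType R) (p : X -> R) : sublinear p ->
  exists f : X -> R^o, linear f /\ forall x, f x <= p x.
Proof.
move=> sp; pose T := {q : X -> R | sublinear q /\ forall x, q x <= p x}.
pose r (q1 q2 : T) : bool := `[< forall x, sval q2 x <= sval q1 x >].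
have [| | | |q qmax] := @Zorn T r.
- by move=> q; apply/asboolP.
- move=> q1 q2 q3 /asboolP h1 /asboolP h2; apply/asboolP => x.
  exact: le_trans (h2 x) (h1 x).
- move=> [q1 P1] [q2 P2] /asboolP/= h1 /asboolP/= h2.
  by apply: eq_exist; apply/funext => x; apply/le_anti; rewrite h1 h2.
- move=> A totA; have [[q0 Aq0]|A0] := pselect (A !=set0); last first.
    exists (exist _ p (conj sp (fun x => lexx (p x)))) => q Aq.
    by exfalso; apply: A0; exists q.
  pose m x : R := inf [set sval q x | q in A].
  have hlb x : has_lbound [set sval q x | q in A].
    exists (- p (- x)) => _ [[q [sq qp]] Aq <-] /=.
    by rewrite (le_trans _ (subl_opp x sq))// lerN2.
  have le q x : A q -> m x <= sval q x.
    by move=> Aq; apply: ge_inf; [exact: hlb|exists q].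
  have ge c x : (forall q, A q -> c <= sval q x) -> c <= m x.
    move=> h; apply: lb_le_inf; first by exists (sval q0 x), q0.
    by move=> _ [q Aq <-]; exact: h.
  (* For subadditivity, the smaller of two members of the chain serves for
     both terms of the sum. *)
  have sm : sublinear m.
    split.
      move=> x y; rewrite -lerBlDr; apply: (ge _ _) => q1 Aq1.
      rewrite lerBlDr -lerBlDl; apply: (ge _ y) => q2 Aq2; rewrite lerBlDl.
      have [/asboolP h|/asboolP h] := totA _ _ Aq1 Aq2.
        apply: le_trans (le _ _ Aq2) _.
        apply: le_trans (subl_add (svalP q2).1 _ _) _.
        by rewrite lerD2r.
      apply: le_trans (le _ _ Aq1) _.
      apply: le_trans (subl_add (svalP q1).1 _ _) _.
      by rewrite lerD2l.
    move=> a x; rewrite le_eqVlt => /predU1P[<-|a0].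
      rewrite mul0r scale0r; apply: le_trans (le _ _ Aq0) _.
      by rewrite (subl0 (svalP q0).1).
    rewrite -ler_pdivrMl//; apply: (ge _ _) => q Aq; rewrite ler_pdivrMl//.
    apply: le_trans (le _ _ Aq) _; apply: (subl_pos (svalP q).1); exact: ltW.
  have mp x : m x <= p x.
    by apply: le_trans (le _ _ Aq0) _; exact: (svalP q0).2.
  by exists (exist _ m (conj sm mp)) => q Aq; apply/asboolP => x /=; exact: le.
have [sq qp] := svalP q; exists (sval q); split; last exact: qp.
have qD x y : sval q (x + y) = sval q x + sval q y.
  apply/le_anti; rewrite (subl_add sq)/=.
  have [s1 s2 s3] := subl_shiftP y sq.
  have s2p x' : subl_shift (sval q) y x' <= p x' by apply: le_trans (s2 _) (qp _).
  have := qmax (exist _ (subl_shift (sval q) y) (conj s1 s2p)).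
  have h : r q (exist _ (subl_shift (sval q) y) (conj s1 s2p)).
    by apply/asboolP => x' /=; exact: s2.
  move=> /(_ h) E; have := s3 x; rewrite -{2 3}E/= => _.
  have {}E : subl_shift (sval q) y x = sval q x by rewrite -{2}E.
  by have := s3 x; rewrite E; lra.
have q0 : sval q 0 = 0 by exact: subl0.
have qN x : sval q (- x) = - sval q x.
  by have := qD x (- x); rewrite subrr q0; lra.
have qZ0 (a : R) x : 0 <= a -> sval q (a *: x) = a * sval q x.
  move=> a0; apply/le_anti; rewrite (subl_pos sq)//=.
  by have := subl_pos sq (- x) a0; rewrite scalerN !qN; lra.
move=> a x y; rewrite qD; congr (_ + _); have [/qZ0 //|/ltW a0] := leP 0 a.
by rewrite -[a *: x]opprK -scaleNr qN qZ0 ?oppr_ge0//; rewrite mulNr opprK.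
Qed.

End HahnBanach.

(** * Norming functionals and a criterion for failing the Grothendieck property *)

Section NormedDual.
Context {R : realType}.

Lemma dual_make (X : normedModType R) (f : X -> R^o) (c : R) : linear f ->
  (forall x, `|f x| <= c * `|x|) -> exists g : dual X, forall x, g x = f x.
Proof. exact: bopE_lin. Qed.

Lemma ler_dualN (X : normedModType R) (f : dual X) x : `|f x| <= `|f| * `|x|.
Proof. exact: (ler_opnorm (f : bop X R^o)). Qed.

Lemma dualN_norm_le (X : normedModType R) (f : dual X) (c : R) : 0 <= c ->
  (forall x, `|f x| <= c * `|x|) -> `|f| <= c.
Proof. exact: (@opnorm_le R X R^o f). Qed.

(** Hahn-Banach applied to the norm lowered along [x]: a linear functional
    below it is below the norm and at most [- `|x|] at [- x]. *)
Lemma norming_functional (X : normedModType R) (x : X) :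
  exists f : dual X, `|f| <= 1 /\ f x = `|x|.
Proof.
have sn : sublinear (fun x : X => `|x|).
  split; first exact: ler_normD.
  by move=> a y a0; rewrite normrZ ger0_norm.
have [s1 s2 s3] := subl_shiftP x sn.
have [f [lf fp]] := hahn_banach s1.
have fn y : f y <= `|y| by exact: le_trans (fp _) (s2 _).
pose g := GRing.isLinear.Build R X R^o *:%R f lf.
pose h : {linear X -> R^o} := HB.pack f g.
have fN y : f (- y) = - f y := linearN h y.
have fb y : `|f y| <= 1 * `|y|.
  by rewrite mul1r ler_norml fn andbT; have := fn (- y); rewrite fN normrN; lra.
have [k kE] := dual_make lf fb; exists k; split.
  by apply: dualN_norm_le => // y; rewrite kE; exact: fb.
rewrite kE; apply/le_anti; rewrite fn/=.
have := le_trans (fp (- x)) (s3 (- x)); rewrite addNr normr0 fN; lra.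
Qed.

Lemma norming_vector (X : normedModType R) (f : dual X) (c : R) : 0 <= c ->
  c < `|f| -> exists2 x, `|x| <= 1 & c < f x.
Proof.
move=> c0 cf; apply: contrapT => h.
have fc y : `|y| <= 1 -> f y <= c.
  move=> y1; rewrite leNgt; apply/negP => cy; apply: h; by exists y.
have : `|f| <= c; last by rewrite leNgt cf.
apply: dualN_norm_le => // x; have [->|x0] := eqVneq x 0.
  by rewrite linear0 !normr0 mulr0.
have nx : 0 < `|x| by rewrite normr_gt0.
have n1 : `| `|x|^-1 *: x | <= 1.
  by rewrite normrZ ger0_norm ?invr_ge0// mulVf// gt_eqF.
rewrite -ler_pdivrMr// mulrC.
have -> : `|x|^-1 * `|f x| = `|f (`|x|^-1 *: x)|.
  by rewrite linearZ/= normrM (ger0_norm (x := `|x|^-1))// invr_ge0.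
rewrite ler_norml fc// andbT.
have := fc (- (`|x|^-1 *: x)); rewrite normrN linearN/= => /(_ n1).
by rewrite lerNl.
Qed.

Lemma ultra_bounded_cvg (T : Type) (U : set_system T) (g : T -> R) (c : R) :
  UltraFilter U -> (forall t, `|g t| <= c) -> cvg (g @ U).
Proof.
move=> UU gc.
have := @segment_compact R (- c) c; rewrite compact_ultra => /(_ (g @ U)).
have gU : UltraFilter (g @ U).
  split; first exact: fmap_proper_filter.
  move=> G PG sub; apply/seteqP; split => // A GA.
  have [//|UA] := in_ultra_setVsetC (g @^-1` A) UU.
  have h : G (~` A) by exact: sub.
  by have [x []] := @filter_ex _ G _ _ (filterI GA h).
case.
  rewrite /fmap/=; apply: filterE => t /=; rewrite in_itv/=.
  by have := gc t; rewrite ler_norml.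
by move=> l [_ gl]; apply/cvg_ex; exists l.
Qed.

(** The ultrafilter limit of the evaluations at the [u k] is a functional on
    the dual that stays above [d] on the whole sequence [psi]. *)
Lemma not_grothendieck (X : completeNormedModType R) (psi : nat -> dual X)
    (u : nat -> X) (c d : R) : weak_star_null psi -> 0 < d ->
  (forall k, `|u k| <= c) ->
  (forall n k, (n <= k)%N -> d <= psi n (u k)) -> ~ grothendieck X.
Proof.
move=> psi0 d0 uc psiu GX.
have [U [UU sU]] := @ultraFilterLemma nat \oo _.
have c0 : 0 <= c by rewrite (le_trans _ (uc 0%N)).
have bd (f : dual X) k : `|f (u k)| <= c * `|f|.
  by rewrite mulrC (le_trans (ler_dualN _ _))// ler_wpM2l.
have cv (f : dual X) : cvg ((fun k => f (u k) : R) @ U).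
  exact: (ultra_bounded_cvg UU (bd f)).
pose Phi (f : dual X) : R^o := lim ((fun k => f (u k) : R) @ U).
have lPhi : linear Phi.
  move=> a f g; rewrite /Phi.
  apply: cvg_lim => //.
  apply: cvgD; last exact: cv.
  by apply: cvgZr; exact: cv.
have PhiE : forall f, `|Phi f| <= c * `|f|.
  move=> f; rewrite ler_norml; apply/andP; split.
    apply: limr_ge; first exact: cv.
    by apply: nearW => k; have := bd f k; rewrite ler_norml => /andP[].
  apply: limr_le; first exact: cv.
  by apply: nearW => k; have := bd f k; rewrite ler_norml => /andP[].
have [P PE] := dual_make lPhi PhiE.
have := GX _ psi0 P => /cvgrPdist_lt /(_ _ d0)[N _ /(_ N)/=].
rewrite sub0r normrN PE => /(_ (leqnn _)).
have : d <= Phi (psi N).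
  apply: limr_ge; first exact: cv.
  by apply: sU; exists N => // k /= Nk; exact: psiu.
by move=> h1 h2; have := le_lt_trans (ler_norm _) h2; lra.
Qed.

End NormedDual.

(** * Banach lattices and their duals *)

Section LatticeFacts.
Context {R : realType} {X : banachLatticeType R}.
Implicit Types (x y z : X).

Lemma lle_subr x y : 0 <=l y -> x - y <=l x.
Proof. by move=> y0; rewrite -lsubr_ge0 opprB addrC subrK. Qed.

Lemma ljoin_le_add x y : 0 <=l x -> 0 <=l y -> ljoin x y <=l x + y.
Proof.
move=> x0 y0; rewrite lle_joinl; apply/andP; split.
  by rewrite -{1}[x]addr0 lleD.
by rewrite -{1}[y]add0r lleD.
Qed.

Lemma lmeetE x y : lmeet x y = y - lpos (y - x).
Proof.
apply/lle_anti/andP; split.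
  have : lpos (y - x) <=l y - lmeet x y.
    rewrite lle_joinl lsubr_ge0 lmeet_ler andbT.
    by apply: lleD => //; rewrite lleN2 lmeet_lel.
  by rewrite -lsubr_ge0 addrAC lsubr_ge0.
rewrite lle_meetr lle_subr ?lpos_ge0// andbT lle_subl addrC.
by have := le_lpos (y - x); rewrite lle_subl.
Qed.

Lemma lmeet_lpos_lneg x : lmeet (lneg x) (lpos x) = 0.
Proof. by rewrite lmeetE -lpos_lneg subrr. Qed.

End LatticeFacts.

Section DualFacts.
Context {R : realType} {X : banachLatticeType R}.
Implicit Types (x y z : X) (f g : dual X).

Lemma dleP f g : f <=l g <-> forall x, 0 <=l x -> f x <= g x :> R.
Proof. by split=> [/asboolP//|h]; apply/asboolP. Qed.

Lemma dual_ge0 f x : 0 <=l f -> 0 <=l x -> 0 <= f x :> R.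
Proof. by move=> /dleP; apply. Qed.

Lemma dual_homo f x y : 0 <=l f -> x <=l y -> f x <= f y :> R.
Proof.
by move=> f0 xy; rewrite -subr_ge0 -linearB/= dual_ge0// lsubr_ge0.
Qed.

Lemma dual_split f x : f x = lpos f x - lneg f x :> R.
Proof. by rewrite {1}[f]lpos_lneg. Qed.

Lemma dual_eq0P f : (forall x, 0 <=l x -> f x = 0) -> f = 0.
Proof.
move=> h; apply: dual_ext => x.
by rewrite [x]lpos_lneg linearB/= !h ?lpos_ge0 ?lneg_ge0// subrr.
Qed.

Lemma ler_dual_labs f x : `|f x| <= labs f (labs x).
Proof.
have h y : f y <= labs f (labs y) :> R.
  have -> : f y = (lpos f (lpos y) - lneg f (lpos y)) -
      (lpos f (lneg y) - lneg f (lneg y)) :> R.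
    by rewrite -!dual_split -linearB/= -lpos_lneg.
  have -> : labs f (labs y) = (lpos f (lpos y) + lpos f (lneg y)) +
      (lneg f (lpos y) + lneg f (lneg y)) :> R.
    by rewrite [labs f]labs_lpos_lneg dualDE labs_lpos_lneg !linearD.
  have E (a b c d : R) : 0 <= a -> 0 <= b -> 0 <= c -> 0 <= d ->
    (a - b) - (c - d) <= (a + c) + (b + d) by lra.
  by apply: E; rewrite dual_ge0 ?lpos_ge0 ?lneg_ge0.
rewrite ler_norml h andbT lerNl -(labsN x).
by have := h (- x); rewrite linearN.
Qed.

(** The nontrivial half of the Riesz-Kantorovich formula for meets; it comes
    from the formula defining the positive part of [g - f] as a supremum. *)
Lemma dual_meet_approx f g x (e : R) : 0 <=l x -> 0 < e -> exists y,
  [/\ 0 <=l y, y <=l x & f y + g (x - y) <= lmeet f g x + e].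
Proof.
move=> x0 e0; rewrite lmeetE.
have -> : (g - lpos (g - f)) x = g x - dpos_fun (g - f) x :> R.
  rewrite -dposE// -[LHS]/(g x - (lpos (g - f)) x); congr (_ - _).
  by rewrite -[lpos _]/(0 + dpos (g - f - 0)) add0r subr0.
apply: contrapT => h.
have : dpos_fun (g - f) x <= dpos_fun (g - f) x - e; last by lra.
apply: dpos_le => // y y0 yx; rewrite leNgt; apply/negP => hy; apply: h.
have E (a b c d : R) : c - e < b - a -> a + (d - b) <= d - c + e by lra.
exists y; split=> //; rewrite linearB/=; apply: E.
by move: hy; rewrite dualDE dualNE.
Qed.

Lemma norm_le_all_eq0 x : (forall e : R, 0 < e -> `|x| <= e) -> x = 0.
Proof.
move=> h; apply/eqP; rewrite -normr_le0; apply/ler_addgt0Pr => e e0.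
by rewrite add0r h.
Qed.

Lemma lle_lim_ge (x : nat -> X) l y N : x @ \oo --> l ->
  (forall n, (N <= n)%N -> y <=l x n) -> y <=l l.
Proof.
move=> xl h; rewrite -lsubr_ge0; apply: lcone_closed => e e0.
have /cvgrPdist_le /(_ _ e0) [M _ Me] := xl.
exists (x (maxn M N) - y); first by rewrite lsubr_ge0 h// leq_maxr.
have := Me _ (leq_maxl M N); rewrite /= distrC => /(le_trans _); apply.
by rewrite opprB addrA addrNK.
Qed.

Lemma lle_lim_le (x : nat -> X) l y N : x @ \oo --> l ->
  (forall n, (N <= n)%N -> x n <=l y) -> l <=l y.
Proof.
move=> /cvgN xl h; rewrite -lleN2; apply: (@lle_lim_ge _ _ _ N xl) => n Nn.
by rewrite lleN2 h.
Qed.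

Lemma lle_seq (x : nat -> X) : (forall n, x n <=l x n.+1) ->
  forall m n, (m <= n)%N -> x m <=l x n.
Proof.
move=> h m n; elim: n => [|n IH]; first by rewrite leqn0 => /eqP ->.
rewrite leq_eqVlt => /predU1P[->//|]; rewrite ltnS => /IH mn.
exact: lle_trans mn (h n).
Qed.

Lemma lle_lim_incr (x : nat -> X) l : x @ \oo --> l ->
  (forall n, x n <=l x n.+1) -> forall n, x n <=l l.
Proof.
by move=> xl h n; apply: (lle_lim_ge (N := n) xl) => m; exact: lle_seq.
Qed.

Lemma dual_cvg f (x : nat -> X) l : x @ \oo --> l ->
  (fun n => f (x n) : R) @ \oo --> (f l : R).
Proof.
by move=> xl; apply: continuous_cvg => //; exact: (bopP f).2.
Qed.

Lemma dual_lim_le f (x : nat -> X) l (c : R) : x @ \oo --> l ->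
  (forall n, f (x n) <= c :> R) -> f l <= c :> R.
Proof.
move=> /(@dual_cvg f) xl h; rewrite -(cvg_lim _ xl)//.
by apply: limr_le; [apply/cvg_ex; exists (f l)|exact: nearW].
Qed.

End DualFacts.
Arguments dual_cvg {R X} f [x l].

(** * KB-spaces *)

Section KB.
Context {R : realType}.

(** KB stands for Kantorovich-Banach. *)
Definition kb_space (X : banachLatticeType R) : Prop :=
  forall (x : nat -> X) (c : R), (forall n, 0 <=l x n) ->
    (forall n, x n <=l x n.+1) -> (forall n, `|x n| <= c) ->
    exists l : X, x @ \oo --> l.

Context {X : banachLatticeType R}.
Context (kbX : kb_space X).
Implicit Types (x y z : X) (f g : dual X).

(** Greedy exhaustion: every step realizes at least half of the largest
    possible increase in norm.  The steps tend to zero since the sequence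
    converges, hence nothing is left above its limit. *)
Lemma kb_maximal (D : set X) (c : R) : D !=set0 ->
  (forall x, D x -> 0 <=l x /\ `|x| <= c) ->
  (forall (x : nat -> X) l, (forall n, D (x n)) ->
    (forall n, x n <=l x n.+1) -> x @ \oo --> l -> D l) ->
  exists m, D m /\ forall x, D x -> m <=l x -> x = m.
Proof.
move=> [z0 Dz0] Dc Dlim.
have /choice[g gP] z : exists y, D z -> [/\ D y, z <=l y &
    forall w, D w -> z <=l w -> `|w - z| <= 2 * `|y - z|].
  have [Dz|] := pselect (D z); last by exists z.
  pose A := [set `|w - z| | w in [set w | D w /\ z <=l w]].
  have hA : has_sup A.
    split; first by exists `|z - z|, z.
    exists (c + c) => _ [w [Dw _] <-].
    by rewrite (le_trans (ler_normB _ _))// lerD// (Dc _ _).2.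
  have ubA w : D w -> z <=l w -> `|w - z| <= sup A.
    by move=> Dw zw; apply: ub_le_sup; [exact: hA.2|exists w].
  have [s0|s0] := leP (sup A) 0.
    exists z => _; split=> // w Dw zw; rewrite subrr normr0 mulr0.
    exact: le_trans (ubA _ Dw zw) s0.
  have s2 : 0 < sup A / 2 by rewrite divr_gt0.
  have [_ [y [Dy zy] <-] sy] := sup_adherent s2 hA.
  exists y => _; split=> // w Dw zw; apply: le_trans (ubA _ Dw zw) _.
  lra.
pose x n := iter n g z0.
have Dx n : D (x n) by elim: n => //= n /gP[].
have incr n : x n <=l x n.+1 by have [] := gP _ (Dx n).
have [m xm] := kbX (fun n => (Dc _ (Dx n)).1) incr (fun n => (Dc _ (Dx n)).2).
have Dm := Dlim _ _ Dx incr xm.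
exists m; split=> // y Dy my; apply/eqP; rewrite -subr_eq0; apply/eqP.
apply: norm_le_all_eq0 => e e0.
have e4 : 0 < e / 4 by rewrite divr_gt0.
have /cvgrPdist_le /(_ _ e4) [N _ Ne] := xm.
have xy : x N <=l y by apply: lle_trans my; exact: (lle_lim_incr xm incr).
have [_ _ /(_ _ Dy xy) h] := gP _ (Dx N).
apply: (@le_trans _ _ `|y - x N|).
  apply: ler0_norm_le; first by rewrite lsubr_ge0.
  by rewrite lleD// lleN2; exact: (lle_lim_incr xm incr).
apply: le_trans h _; rewrite -/(x N.+1).
have h1 := Ne N (leqnn N); have h2 := Ne N.+1 (leqnSn N); rewrite /= in h1 h2.
have : `|x N.+1 - x N| <= e / 4 + e / 4; last by lra.
have -> : x N.+1 - x N = (m - x N) - (m - x N.+1).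
  by rewrite opprB [RHS]addrC addrA subrK.
by rewrite (le_trans (ler_normB _ _))// lerD.
Qed.

(** [x'] is what remains of [x] after removing a maximal element of the null
    set of [f] in the interval from [0] to [x]. *)
Lemma kb_carrier f x : 0 <=l f -> 0 <=l x -> exists x',
  [/\ 0 <=l x', x' <=l x, f (x - x') = 0 &
      forall z, 0 <=l z -> z <=l x' -> f z = 0 -> z = 0].
Proof.
move=> f0 x0; pose D := [set z | [/\ 0 <=l z, z <=l x & f z = 0]].
have [||w lw|m [[m0 mx fm] mmax]] := @kb_maximal D `|x|.
- by exists 0; split=> //; rewrite linear0.
- by move=> z [z0 zx _]; split=> //; exact: ler0_norm_le.
- move=> Dw incr wl; split.
  + by apply: (lle_lim_ge (N := 0%N) wl) => n _; have [] := Dw n.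
  + by apply: (lle_lim_le (N := 0%N) wl) => n _; have [] := Dw n.
  + have wl' := dual_cvg f wl.
    have E : (fun n => f (w n) : R) = fun=> 0 by apply/funext => n; have [] := Dw n.
    by rewrite -(cvg_lim _ wl')// E lim_cst.
exists (x - m); rewrite lsubr_ge0 lle_subr// opprB addrC subrK; split=> //.
move=> z z0 zxm fz.
have /mmax : D (m + z).
  split; first exact: laddr_ge0.
    by have := lleD2r m zxm; rewrite subrK addrC.
  by rewrite linearD/= fm fz addr0.
have -> : m <=l m + z by rewrite -{1}[m]addr0 lleD.
move=> /(_ isT) /eqP; rewrite -subr_eq0 addrC addrA addNr add0r => /eqP //.
Qed.

(** A Borel-Cantelli argument: [y] is the upper limit of vectors [y k] with
    [f (y k) + g (x - y k) <= 2 ^ - k.+1].  The summability of [f (y k)] gives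
    [f y = 0], and [x - y] is a limit of vectors below every late
    [x - y k]. *)
Lemma kb_disjoint_split f g x : 0 <=l f -> 0 <=l g -> 0 <=l x ->
  lmeet f g x = 0 :> R ->
  exists y, [/\ 0 <=l y, y <=l x, f y = 0 & g (x - y) = 0].
Proof.
move=> f0 g0 x0 fg0; pose h (n : nat) : R := 2^-1 ^+ n.
have h0 n : 0 < h n by rewrite exprn_gt0// invr_gt0.
have hS n : h n.+1 + h n.+1 = h n by rewrite /h exprS; lra.
have hlt (e : R) : 0 < e -> exists n, h n <= e.
  move=> e0; have /cvgrPdist_le /(_ _ e0) [N _ /(_ N (leqnn N))] :
    h @ \oo --> (0 : R).
    by apply: cvg_expr; rewrite ger0_norm ?invr_ge0// invf_lt1// ltr1n.
  by rewrite /= sub0r normrN ger0_norm ?(ltW (h0 _))// => hN; exists N.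
have /choice[y yP] k : exists y,
    [/\ 0 <=l y, y <=l x & f y + g (x - y) <= h k.+1].
  have [y [y0 yx yk]] := dual_meet_approx f g x0 (h0 k.+1).
  by exists y; split=> //; move: yk; rewrite fg0 add0r.
have fy k : f (y k) <= h k.+1 :> R.
  have [y0 yx yk] := yP k; apply: le_trans yk.
  by rewrite lerDl dual_ge0// lsubr_ge0.
have gy k : g (x - y k) <= h k.+1 :> R.
  by have [y0 yx yk] := yP k; apply: le_trans yk; rewrite lerDr dual_ge0.
(* [J j n] is the join of [y j], ..., [y (j + n)]; its limit [w j] in [n] is
   the supremum of the tail, and the [w j] decrease to the upper limit. *)
pose J j n : X := iteri n (fun i z => ljoin z (y (j + i).+1)) (y j).
have JS j n : J j n.+1 = ljoin (J j n) (y (j + n).+1) by [].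
have Jx j n : J j n <=l x.
  elim: n => [|n IH]; first by have [] := yP j.
  by rewrite JS lle_joinl IH; have [] := yP (j + n).+1.
have Jincr j n : J j n <=l J j n.+1 by rewrite JS lle_ljoin.
have J0 j n : 0 <=l J j n.
  by apply: lle_trans (lle_seq (Jincr j) (leq0n n)); have [] := yP j.
have yJ j n : y (j + n)%N <=l J j n.
  by case: n => [|n]; rewrite ?addn0// JS addnS lle_rjoin.
have /choice[w Jw] j : exists w : X, J j @ \oo --> w.
  by apply: (kbX (c := `|x|)) => // n; exact: ler0_norm_le.
have wx j : w j <=l x by apply: (lle_lim_le (N := 0%N) (Jw j)).
have yw j k : (j <= k)%N -> y k <=l w j.
  move=> jk; rewrite -(subnKC jk).
  exact: lle_trans (yJ _ _) (lle_lim_incr (Jw j) (Jincr j) _).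
have JSle j n : J j.+1 n <=l J j n.+1.
  elim: n => [|n IH]; first by rewrite JS addn0 lle_rjoin.
  rewrite (JS j.+1 n) lle_joinl (lle_trans IH (Jincr _ _)) andTb.
  by have := yJ j n.+2; rewrite !addnS addSn.
have wdecr j : w j.+1 <=l w j.
  apply: (lle_lim_le (N := 0%N) (Jw j.+1)) => n _.
  exact: lle_trans (JSle _ _) (lle_lim_incr (Jw j) (Jincr j) _).
have w0 j : 0 <=l w j by apply: (lle_lim_ge (N := 0%N) (Jw j)).
have fJ j n : f (J j n) <= h j - h (j + n).+1 :> R.
  elim: n => [|n IH].
    by rewrite addn0; have := fy j; have := hS j; rewrite -[J j 0%N]/(y j); lra.
  have [yS0 _ _] := yP (j + n).+1.
  have := dual_homo f0 (ljoin_le_add (J0 j n) yS0); rewrite -JS linearD/= => h1.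
  have h2 := fy (j + n).+1; have h3 := hS (j + n).+1; rewrite addnS.
  have h4 : f (J j n) + f (y (j + n).+1) <= h j - h (j + n).+1 + h (j + n).+2.
    exact: lerD.
  by apply: le_trans h1 (le_trans h4 _); lra.
have fw j : f (w j) <= h j :> R.
  apply: (dual_lim_le (Jw j)) => n; apply: le_trans (fJ j n) _.
  by rewrite lerBlDr lerDl ltW.
have [l xwl] : exists l : X, (fun j => x - w j) @ \oo --> l.
  apply: (kbX (c := `|x|)) => n.
  - by rewrite lsubr_ge0.
  - by rewrite lleD// lleN2.
  - by apply: ler0_norm_le; [rewrite lsubr_ge0|exact: lle_subr].
have xwl_le j : x - w j <=l l.
  by apply: (lle_lim_incr xwl) => n; rewrite lleD// lleN2.
exists (x - l); split.
- rewrite lsubr_ge0; apply: (lle_lim_le (N := 0%N) xwl) => n _; exact: lle_subr.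
- apply: lle_subr; apply: (lle_lim_ge (N := 0%N) xwl) => n _.
  by rewrite lsubr_ge0.
- have xl0 : 0 <=l x - l.
    rewrite lsubr_ge0; apply: (lle_lim_le (N := 0%N) xwl) => n _; exact: lle_subr.
  apply/le_anti; rewrite [X in _ && X]dual_ge0// andbT.
  apply/ler_addgt0Pr => e e0; rewrite add0r; have [n hn] := hlt _ e0.
  apply: le_trans hn; apply: le_trans (fw n); apply: dual_homo => //.
  by have := xwl_le n; rewrite !lle_subl addrC.
- have l0 : 0 <=l l.
    by apply: (lle_lim_ge (N := 0%N) xwl) => n _; rewrite lsubr_ge0.
  rewrite opprB addrC subrK; apply/le_anti; rewrite [X in _ && X]dual_ge0// andbT.
  apply: (dual_lim_le xwl) => j; apply/ler_addgt0Pr => e e0; rewrite add0r.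
  have [n hn] := hlt _ e0; apply: le_trans hn.
  have : g (x - y (maxn j n)) <= h n :> R.
    apply: le_trans (gy _) _; rewrite /h; apply: ler_wiXn2l.
    - by rewrite invr_ge0.
    - by rewrite invf_le1// ler1n.
    - by rewrite (leq_trans (leq_maxr j n)).
  apply: le_trans; apply: dual_homo => //; rewrite lleD// lleN2.
  by apply: yw; exact: leq_maxl.
Qed.

End KB.

(** * Reflexivity of KB-spaces with KB dual *)

Section Evaluation.
Context {R : realType} {E : banachLatticeType R}.

Lemma eval_bounded (x : E) :
  (fun f : dual E => (f x : R^o)) \in bounded_op (dual E) R^o.
Proof.
by apply: (@linear_bop _ _ _ _ `|x|) => // f; rewrite mulrC ler_dual.
Qed.

Definition eval (x : E) : dual (dual E) := Bop (eval_bounded x).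

Lemma evalE x f : eval x f = f x. Proof. by []. Qed.

Lemma eval_ge0 x : 0 <=l x -> 0 <=l eval x.
Proof. by move=> x0; apply/dleP => f f0; rewrite evalE dual_ge0. Qed.

End Evaluation.

Section HahnDecomposition.
Context {R : realType} {X : banachLatticeType R}.
Context (kbX : kb_space X).

(** Hahn decomposition of [f] below [x]: the positive and negative parts of
    [f] are disjoint, and [y] is the component of [x] on which the negative
    part vanishes. *)
Lemma kb_hahn (f : dual X) (x : X) : 0 <=l x -> 0 < f x :> R ->
  exists y, [/\ 0 <=l y, y <=l x, 0 < f y :> R &
    forall z, 0 <=l z -> z <=l y -> f z = lpos f z /\ 0 <= f z :> R].
Proof.
move=> x0 fx; have [|y [y0 yx ny py]] :=
  kb_disjoint_split kbX (lneg_ge0 f) (lpos_ge0 f) x0.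
  by rewrite lmeet_lpos_lneg.
have nz z : 0 <=l z -> z <=l y -> lneg f z = 0.
  move=> z0 zy; apply/le_anti; rewrite [X in _ && X]dual_ge0 ?lneg_ge0// andbT.
  by rewrite -ny; apply: dual_homo => //; exact: lneg_ge0.
exists y; split=> //; last first.
  move=> z z0 zy; have -> : f z = lpos f z by rewrite dual_split nz// subr0.
  by split=> //; apply: dual_ge0 => //; exact: lpos_ge0.
have -> : f y = lpos f y :> R by rewrite dual_split nz// subr0.
apply: (lt_le_trans fx).
have <- : lpos f x = lpos f y :> R.
  by apply/eqP; rewrite -subr_eq0 -py linearB.
rewrite dual_split gerBl; apply: dual_ge0 => //; exact: lneg_ge0.
Qed.

(** Carrier of the positive part of [f] inside the positive component. *)
Lemma kb_hahn_strict (f : dual X) (x : X) : 0 <=l x -> 0 < f x :> R ->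
  exists y, [/\ 0 <=l y, y <=l x, 0 < f y :> R &
    forall z, 0 <=l z -> z <=l y -> f z <= 0 :> R -> z = 0].
Proof.
move=> x0 fx; have [y [y0 yx fy ypos]] := kb_hahn x0 fx.
have fpos w : 0 <=l w -> w <=l y -> lpos f w = f w.
  by move=> w0 /(ypos w w0)[].
have [z [z0 zy pz zs]] := kb_carrier kbX (lpos_ge0 f) y0.
exists z; split=> //; first exact: lle_trans yx.
  rewrite -(fpos z)//; suff <- : lpos f y = lpos f z :> R by rewrite fpos.
  by apply/eqP; rewrite -subr_eq0 -pz linearB.
move=> w w0 wz fw; apply: zs => //; apply/le_anti.
have wy := lle_trans wz zy.
by rewrite fpos// fw (ypos _ w0 wy).2.
Qed.

End HahnDecomposition.

Section Reflexivity.
Context {R : realType} {E : banachLatticeType R}.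
Context (kbE : kb_space E) (kbE' : kb_space (dual E)).

(** Choose [f] in the carrier of [phi] and [x] with [0 < f x].  Then the meet
    [chi] of [phi] and [eval x] does not vanish at [f], since otherwise it
    would split [f] into a [phi]-null part and an [x]-null part.  A Hahn
    decomposition of [chi - e *: eval x] gives [f'] on whose order interval
    [e *: eval x <= chi].  Cutting [x] down to the carrier [x'] of [f'] makes
    [e *: x'] the wanted minorant: functionals disjoint from [f'] do not see
    [x']. *)
Lemma kb_bidual_minorant (phi : dual (dual E)) : 0 <=l phi -> phi != 0 ->
  exists y : E, [/\ 0 <=l y, y != 0 & eval y <=l phi].
Proof.
move=> phi0 phin0.
have [f0 f00 phif0] : exists2 f, 0 <=l f & 0 < phi f :> R.
  apply: contrapT => h; move/eqP: phin0; apply; apply: dual_eq0P => f f0.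
  apply/le_anti; rewrite [X in _ && X]dual_ge0// andbT leNgt; apply/negP => pf.
  by apply: h; exists f.
have [f [fge0 _ phif fs]] := kb_hahn_strict kbE' f00 phif0.
have [x x0 fx] : exists2 x, 0 <=l x & 0 < f x :> R.
  apply: contrapT => h; suff f_0 : f = 0 by move: phif; rewrite f_0 linear0 ltxx.
  apply: dual_eq0P => y y0; apply/le_anti.
  rewrite [X in _ && X]dual_ge0// andbT leNgt; apply/negP => fy.
  by apply: h; exists y.
pose chi := lmeet phi (eval x).
have chi0 : 0 <=l chi by rewrite lle_meetr phi0 eval_ge0.
have chi_phi : chi <=l phi by exact: lmeet_lel.
have chi_x : chi <=l eval x by exact: lmeet_ler.
have chif : 0 < chi f :> R.
  rewrite lt_neqAle dual_ge0// andbT eq_sym; apply/eqP => chif.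
  have [g [g0 gf phig fg]] := kb_disjoint_split kbE' phi0 (eval_ge0 x0) fge0 chif.
  have g_0 : g = 0 by apply: fs => //; rewrite phig.
  by move: fg; rewrite g_0 subr0 evalE => /eqP; rewrite gt_eqF.
have [e e0 efx] : exists2 e : R, 0 < e & e * f x < chi f.
  exists (chi f / 2 / f x); first by rewrite !divr_gt0.
  by rewrite divfK ?gt_eqF// ltr_pdivrMr// ltr_pMr// ltr1n.
have [|f' [f'0 f'f psif' f'pos]] := @kb_hahn _ _ kbE' (chi - e *: eval x) f fge0.
  by rewrite subr_gt0.
have chi_ge g : 0 <=l g -> g <=l f' -> e * g x <= chi g :> R.
  by move=> g0 gf'; rewrite -subr_ge0; exact: (f'pos g g0 gf').2.
have f'x : 0 < f' x :> R.
  have h1 : 0 < chi f' :> R.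
    apply: (@le_lt_trans _ _ (e * f' x)).
      by apply: mulr_ge0; [exact: ltW|exact: (dual_ge0 f'0 x0)].
    by rewrite -subr_gt0; exact: psif'.
  by apply: lt_le_trans h1 _; exact: ((dleP _ _).1 chi_x).
have [x' [x'0 x'x f'x' x's]] := kb_carrier kbE f'0 x0.
exists (e *: x'); split.
- by rewrite lscale_ge0// ltW.
- apply: contra_ltN f'x; rewrite scaler_eq0 gt_eqF//= => /eqP x'_0.
  by have := f'x'; rewrite x'_0 subr0 => ->.
apply: lle_trans chi_phi; apply/dleP => g g0; rewrite leNgt; apply/negP => hg.
have psiE h : (eval (e *: x') - chi) h = e * h x' - chi h :> R.
  by rewrite -[LHS]/(h (e *: x') - chi h) linearZ.
(* [g2] is a part of [g] on which [chi] lies strictly below [e *: eval x'].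
   It is disjoint from [f'], hence null on the carrier [x'] of [f']. *)
have [|g2 [g20 _ psig2 g2s]] := @kb_hahn_strict _ _ kbE' (eval (e *: x') - chi) g g0.
  by rewrite subr_gt0.
have k0 : lmeet f' g2 = 0.
  have k0 : 0 <=l lmeet f' g2 by rewrite lle_meetr f'0.
  apply: g2s => //; first exact: lmeet_ler.
  rewrite psiE subr_le0; apply: le_trans (chi_ge _ k0 (lmeet_lel _ _)).
  by rewrite ler_pM2l//; apply: dual_homo.
have [|z [z0 zx' f'z g2z]] := kb_disjoint_split kbE f'0 g20 x'0.
  by rewrite k0.
have z_0 := x's _ z0 zx' f'z.
move: g2z; rewrite z_0 subr0 => g2x'.
move: psig2; rewrite psiE g2x' mulr0 sub0r oppr_gt0 ltNge.
by rewrite dual_ge0.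
Qed.

(** A maximal vector of [E] below a positive [phi] represents [phi], since
    by [kb_bidual_minorant] a nonzero difference would leave room for more. *)
Lemma kb_reflexive : reflexive_space E.
Proof.
have pos (phi : dual (dual E)) : 0 <=l phi -> exists x, phi = eval x.
  move=> phi0; pose D := [set y : E | 0 <=l y /\ eval y <=l phi].
  have [||w l Dw incr wl|m [[m0 mphi] mmax]] := @kb_maximal _ _ kbE D `|phi|.
  - by exists 0; split=> //; apply/dleP => f f0; rewrite evalE linear0 dual_ge0.
  - move=> y [y0 yphi]; split=> //; have [f [f1 fy]] := norming_functional y.
    rewrite -fy; apply: (@le_trans _ _ (labs f y)).
      by apply: ((dleP _ _).1 (le_labs f)).
    apply: (@le_trans _ _ (phi (labs f))).
      exact: ((dleP _ _).1 yphi _ (labs_ge0 f)).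
    apply: le_trans (ler_norm _) _; apply: le_trans (ler_dual _ _) _.
    by rewrite norm_labs ler_piMr.
  - split; first by apply: (lle_lim_ge (N := 0%N) wl) => n _; have [] := Dw n.
    apply/dleP => f f0; rewrite evalE; apply: (dual_lim_le wl) => n.
    by have [_ /dleP] := Dw n; apply.
  exists m; apply/eqP; rewrite -subr_eq0; apply/negP => /negP phim.
  have pm0 : 0 <=l phi - eval m by rewrite lsubr_ge0.
  have [y [y0 /eqP yn0 yphi]] := kb_bidual_minorant pm0 phim.
  apply: yn0; have Dmy : D (m + y).
    split; first exact: laddr_ge0.
    apply/dleP => f f0; rewrite evalE linearD/= addrC -lerBrDr.
    exact: ((dleP _ _).1 yphi _ f0).
  have /(mmax _ Dmy)/eqP : m <=l m + y by rewrite -{1}[m]addr0 lleD.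
  by rewrite -subr_eq0 addrC addrA addNr add0r => /eqP.
move=> phi; have [x1 h1] := pos _ (lpos_ge0 phi); have [x2 h2] := pos _ (lneg_ge0 phi).
exists (x1 - x2) => f; rewrite linearB/= {1}[phi]lpos_lneg dualDE dualNE.
by rewrite h1 h2.
Qed.

End Reflexivity.

(** * Functionals on the Wittstock tensor product *)

Section WittstockFunctionals.
Context {R : realType} {E F : banachLatticeType R}.
Implicit Types (f : dual E) (h : dual F) (u : seq (E * F)).

Lemma ler_wtensor (T : wtensor E F) f : `|T f| <= `|T| * `|f|.
Proof.
apply: le_trans (ler_opnorm _ f) _; rewrite ler_wpM2r//.
exact: (opnorm_rnorm (wtensor_rop T)).
Qed.

Lemma wdual_bounded f h :
  (fun T : wtensor E F => (h (T f) : R^o)) \in bounded_op (wtensor E F) R^o.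
Proof.
apply: (@linear_bop _ _ _ _ (`|f| * `|h|)) => [a S T|T].
  by rewrite -[RHS](linearP h).
apply: le_trans (ler_dual h _) _.
rewrite [leRHS]mulrC mulrA [leRHS]mulrC ler_wpM2l//; exact: ler_wtensor.
Qed.

(** The functional on the tensor product that is usually written [f (x) h]. *)
Definition wdual f h : dual (wtensor E F) := Bop (wdual_bounded f h).

Lemma wdualE f h T : wdual f h T = h (T f). Proof. by []. Qed.

Lemma wdual_norm f h : `|wdual f h| <= `|f| * `|h|.
Proof.
apply: dualN_norm_le => [|T]; first exact: mulr_ge0.
rewrite wdualE; apply: le_trans (ler_dual h _) _.
rewrite [leRHS]mulrC mulrA [leRHS]mulrC ler_wpM2l//; exact: ler_wtensor.
Qed.

Lemma tensor_op_wtensor u : tensor_op u \in wtensor_op E F.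
Proof. by apply/wtensor_opP => e e0; exists u; rewrite subrr normr0. Qed.

Definition wtensor_of u : wtensor E F := WTensor (tensor_op_wtensor u).

Lemma wtensor_ofE u f : wtensor_of u f = \sum_(p <- u) f p.1 *: p.2.
Proof. exact: tensor_opE. Qed.

Lemma wtensor_of_cons p u : wtensor_of (p :: u) = wtensor_of [:: p] + wtensor_of u.
Proof.
by apply/val_inj; rewrite /= -[LHS]/(tensor_op ([:: p] ++ u)) tensor_op_cat.
Qed.

Lemma wtensor_of_nil : wtensor_of [::] = 0.
Proof. by apply/val_inj; rewrite /= /tensor_op big_nil. Qed.

(** For positive left factors the operator of [u] is dominated by the positive
    operator obtained by replacing the right factors by their moduli, and the
    norm of the latter is controlled by the sum of the left factors. *)
Lemma wtensor_of_norm u (b : R) : 0 <= b ->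
  (forall p, p \in u -> 0 <=l p.1 /\ `|p.2| <= b) ->
  `|wtensor_of u| <= `|\sum_(p <- u) p.1| * b.
Proof.
move=> b0 ub; pose v : seq (E * F) := [seq (p.1, labs p.2) | p <- u].
have vE f : rop_bop (tensor_op v) f = \sum_(p <- u) f p.1 *: labs p.2.
  by rewrite tensor_opE big_map.
have vpos : positive_op (rop_bop (tensor_op v)).
  move=> f f0; rewrite vE big_seq; elim/big_ind: _ => //.
    exact: laddr_ge0.
  move=> p /ub[p0 _]; apply: lscale_ge0; last exact: labs_ge0.
  exact: dual_ge0.
have vdom : dominates (rop_bop (tensor_op v)) (rop_bop (tensor_op u)).
  move=> f; rewrite vE tensor_opE.
  rewrite big_seq [X in _ <=l X]big_seq.
  elim/big_ind2: _ => [|x1 y1 x2 y2 h1 h2|p /ub[p0 _]]; first by rewrite labs0.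
    apply: lle_trans (labsD _ _) _; exact: lleD.
  apply: lle_trans (labsZ_le _ _) _.
  rewrite -lsubr_ge0 -scalerBl lscale_ge0 ?labs_ge0// subr_ge0.
  by apply: le_trans (ler_dual_labs f p.1) _; rewrite (ger0_labs p0).
apply: le_trans (rnorm_le vpos vdom) _; apply: opnorm_le => [|f].
  exact: mulr_ge0.
rewrite vE; apply: (@le_trans _ _ (\sum_(p <- u) labs f p.1 * b)).
  apply: le_trans (ler_norm_sum _ _ _) _.
  rewrite big_seq [leRHS]big_seq; apply: ler_sum => p /ub[p0 pb].
  rewrite normrZ norm_labs; apply: ler_pM => //.
  by apply: le_trans (ler_dual_labs f p.1) _; rewrite (ger0_labs p0).
rewrite -mulr_suml mulrAC ler_wpM2r//.
have -> : \sum_(p <- u) labs f p.1 = labs f (\sum_(p <- u) p.1) :> R.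
  by rewrite linear_sum.
apply: le_trans (ler_norm _) _; apply: le_trans (ler_dual _ _) _.
by rewrite norm_labs mulrC.
Qed.

(** Finite sums of elementary tensors are dense, and the uniform bound [c]
    carries the convergence over to their closure. *)
Lemma wtensor_weak_star_null (psi : nat -> dual (wtensor E F)) (c : R) :
  (forall n, `|psi n| <= c) ->
  (forall x y, (fun n => psi n (wtensor_of [:: (x, y)]) : R) @ \oo --> (0 : R)) ->
  weak_star_null psi.
Proof.
move=> psic psi0 T.
have c0 : 0 <= c by rewrite (le_trans _ (psic 0%N)).
have psiu u : (fun n => psi n (wtensor_of u) : R) @ \oo --> (0 : R).
  elim: u => [|p u IH].
    rewrite wtensor_of_nil; have -> : (fun n => psi n 0 : R) = fun=> 0.
      by apply/funext => n; rewrite linear0.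
    exact: cvg_cst.
  rewrite wtensor_of_cons; case: p => x y.
  have -> : (fun n => psi n (wtensor_of [:: (x, y)] + wtensor_of u) : R) =
    (fun n => (psi n (wtensor_of [:: (x, y)]) : R) + psi n (wtensor_of u)).
    by apply/funext => n; rewrite linearD.
  by rewrite -[X in _ --> X]addr0; exact: cvgD.
apply/cvgrPdist_le => e e0.
have c1 : 0 < c + 1 by rewrite ltr_wpDl.
have e2 : 0 < e / 2 by rewrite divr_gt0.
have ec : 0 < e / 2 / (c + 1) by rewrite divr_gt0.
have /wtensor_opP/(_ _ ec) [u Tu] := valP T.
have /cvgrPdist_le /(_ _ e2) := psiu u; apply: filterS => n.
rewrite !sub0r !normrN => hn.
have -> : psi n T = psi n (T - wtensor_of u) + psi n (wtensor_of u) :> R.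
  by rewrite -linearD subrK.
rewrite [leRHS]splitr; apply: le_trans (ler_normD _ _) _; apply: lerD => //.
apply: le_trans (ler_dualN _ _) _.
apply: (@le_trans _ _ ((c + 1) * (e / 2 / (c + 1)))); last first.
  by rewrite mulrC divfK ?gt_eqF.
apply: ler_pM => //; first by rewrite (le_trans (psic n))// lerDl.
exact: ltW.
Qed.

End WittstockFunctionals.

(** * The dual of the first factor is a KB-space *)

Section DualKB.
Context {R : realType}.

(** The failure of the Cauchy criterion gives uniform gaps arbitrarily far
    out; passing to a subsequence puts them at consecutive indices. *)
Lemma not_kb_space (X : banachLatticeType R) : ~ kb_space X ->
  exists (x : nat -> X) (c d : R), [/\ 0 < d, forall n, 0 <=l x n,
    forall n, x n <=l x n.+1, forall n, `|x n| <= c &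
    forall n, d <= `|x n.+1 - x n|].
Proof.
move=> nkb; apply: contrapT => h; apply: nkb => x c x0 incr xc.
apply/cvg_ex; apply: cauchy_cvg; apply/cauchy_ballP => e e0.
have e2 : 0 < e / 2 by rewrite divr_gt0.
suff [N hN] : exists N, forall m, (N <= m)%N -> `|x m - x N| < e / 2.
  exists (x @` [set m | (N <= m)%N], x @` [set m | (N <= m)%N]) => /=.
    by split; exists N => // m /= Nm; exists m.
  move=> [_ _] [[m /= Nm <-] [n /= Nn <-]]; rewrite -ball_normE/=.
  have -> : x m - x n = (x m - x N) - (x n - x N) by rewrite opprB addrA subrK.
  by rewrite (le_lt_trans (ler_normB _ _))// [e]splitr ltrD ?hN.
apply: contrapT => hN; apply: h.
have /choice[g gP] N : exists m, (N <= m)%N /\ e / 2 <= `|x m - x N|.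
  apply: contrapT => h; apply: hN; exists N => m Nm; rewrite ltNge.
  by apply/negP => hm; apply: h; exists m.
exists (fun n => x (iter n g 0%N)), c, (e / 2); split=> // n.
  by apply: lle_seq => //=; have [] := gP (iter n g 0%N).
by have [] := gP (iter n g 0%N).
Qed.

Lemma increasing_dual_sup (E : banachLatticeType R) (s : nat -> dual E) (c : R) :
  (forall n, s n <=l s n.+1) -> (forall n, `|s n| <= c) ->
  exists H : dual E, (forall n, s n <=l H) /\
    forall x, (fun n => s n x : R) @ \oo --> (H x : R).
Proof.
move=> incr sc.
have sx n x : `|s n x| <= c * `|x|.
  by apply: le_trans (ler_dual _ _) _; rewrite ler_wpM2r.
have nd x : 0 <=l x -> nondecreasing_seq (fun n => s n x : R).
  by move=> x0 m n mn; have /dleP := lle_seq incr mn; apply.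
have cv0 x : 0 <=l x -> cvgn (fun n => s n x : R).
  move=> x0; apply: nondecreasing_is_cvgn; first exact: nd.
  exists (c * `|x|) => _ [n _ <-]; exact: le_trans (ler_norm _) (sx n x).
have cv x : cvgn (fun n => s n x : R).
  have -> : (fun n => s n x : R) = (fun n => (s n (lpos x) : R) - s n (lneg x)).
    by apply/funext => n; rewrite {1}[x]lpos_lneg linearB.
  by apply: is_cvgB; apply: cv0; rewrite ?lpos_ge0 ?lneg_ge0.
pose h x : R^o := limn (fun n => s n x : R).
have lh : linear h.
  move=> a x y; apply: cvg_lim => //.
  have -> : (fun n => s n (a *: x + y) : R) =
     (fun n => a *: (s n x : R) + (s n y : R)).
    by apply/funext => n; rewrite linearP.
  by apply: cvgD; [apply: cvgZr; exact: cv|exact: cv].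
have hb x : `|h x| <= c * `|x|.
  rewrite ler_norml; apply/andP; split.
    apply: limr_ge; first exact: cv.
    by apply: nearW => k; have := sx k x; rewrite ler_norml => /andP[].
  apply: limr_le; first exact: cv.
  by apply: nearW => k; have := sx k x; rewrite ler_norml => /andP[].
have [H HE] := dual_make lh hb; exists H; split; last first.
  by move=> x; rewrite HE; exact: cv.
move=> n; apply/dleP => x x0; rewrite HE.
exact: (nondecreasing_cvgn_le (nd x x0) (cv x)).
Qed.

(** The decreasing functionals [H - s n] tend to zero pointwise.  If the [s n]
    have gaps of size [d], then a vector nearly norming [s k.+1 - s k] also
    sees all [H - s n] with [n <= k], because they dominate that gap. *)
Lemma grothendieck_kb_dual (E F : banachLatticeType R) (y : F) : y != 0 ->
  grothendieck (wtensor E F) -> kb_space (dual E).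
Proof.
move=> y0 GW; apply: contrapT => /not_kb_space[s [c [d [d0 s0 incr sc sd]]]].
have [H [sH sHx]] := increasing_dual_sup incr sc.
have [h [h1 hy]] := norming_functional y.
have ny : 0 < `|y| by rewrite normr_gt0.
have /choice[x xP] k : exists x : E,
    [/\ 0 <=l x, `|x| <= 1 & d / 2 <= (s k.+1 - s k) x].
  have [||x x1 dx] := @norming_vector _ _ (s k.+1 - s k) (d / 2).
  - by rewrite divr_ge0// ltW.
  - by apply: lt_le_trans (sd k); rewrite ltr_pdivrMr// ltr_pMr// ltr1n.
  exists (labs x); rewrite labs_ge0 norm_labs; split=> //.
  apply: le_trans (ltW dx) _; apply: dual_homo; last exact: le_labs.
  by rewrite lsubr_ge0.
pose psi n : dual (wtensor E F) := wdual (H - s n) h.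
have psi0 : weak_star_null psi.
  apply: (@wtensor_weak_star_null _ _ _ _ (`|H| + c)) => [n|x' y'].
    apply: le_trans (wdual_norm _ _) _; apply: (@le_trans _ _ `|H - s n|).
      by rewrite ler_piMr.
    by apply: le_trans (ler_normB _ _) _; rewrite lerD2l.
  have -> : (fun n => psi n (wtensor_of [:: (x', y')]) : R) =
     (fun n => ((H x' : R) - s n x') * h y').
    by apply/funext => n; rewrite /psi wdualE wtensor_ofE big_seq1 linearZ.
  rewrite -[X in _ --> X](mul0r (h y')); apply: cvgM; last exact: cvg_cst.
  by rewrite -(subrr (H x' : R)); apply: cvgB; [exact: cvg_cst|exact: sHx].
apply: (@not_grothendieck _ _ psi (fun k => wtensor_of [:: (x k, y)])
  `|y| (d / 2 * `|y|) psi0) => //.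
- by rewrite mulr_gt0// divr_gt0.
- move=> k; have [x0 x1 _] := xP k.
  have := @wtensor_of_norm _ _ _ [:: (x k, y)] `|y| (ltW ny).
  rewrite big_seq1 => /(_ _)/le_trans; apply; last by rewrite ler_piMl.
  by move=> p; rewrite inE => /eqP ->.
- move=> n k nk; rewrite /psi wdualE wtensor_ofE big_seq1 linearZ/= hy.
  rewrite -[leRHS]/(((H - s n) (x k) : R) * `|y|) ler_wpM2r//.
  have [x0 x1 xk] := xP k; apply: le_trans xk _.
  apply: (dleP _ _).1 x0; apply: lleD; first exact: sH.
  by rewrite lleN2; apply: lle_seq.
Qed.

End DualKB.

(** * Rosenthal's lemma *)

Section Rosenthal.
Context {R : realType}.

(** Split the indices into infinitely many infinite classes.  Either one of
    the classes works, or each class contains an index whose row has more than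
    [e] of its mass inside the class.  Select one such index per class: the
    rows of the selected submatrix have lost mass [e], and induction on [n]
    applies. *)
Lemma rosenthal_bounded (e : R) (n : nat) (a : nat -> nat -> R) : 0 <= e ->
  (forall j s, uniq s -> \sum_(k <- s) a j k <= e *+ n) ->
  exists kappa : nat -> nat, injective kappa /\
    forall j s, uniq s -> j \notin s -> \sum_(k <- s) a (kappa j) (kappa k) <= e.
Proof.
move=> e0; elim: n a => [|n IH] a ae.
  by exists id; split=> // j s us _; rewrite (le_trans (ae j s us)).
pose P (p k : nat) : nat := pickle (p, k).
have Pinj p q k l : P p k = P q l -> (p, k) = (q, l) by exact: (pcan_inj pickleK).
have [[p hp]|hn] := pselect (exists p, forall j s, uniq s -> j \notin s ->
    \sum_(k <- s) a (P p j) (P p k) <= e).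
  by exists (P p); split=> // k l /Pinj[].
have /choice[js hjs] p : exists js : nat * seq nat, [/\ uniq js.2, js.1 \notin js.2 &
    e < \sum_(k <- js.2) a (P p js.1) (P p k)].
  apply: contrapT => h; apply: hn; exists p => j s us js.
  by rewrite leNgt; apply/negP => hlt; apply: h; exists (j, s).
pose lam p := P p (js p).1.
have lam_inj : injective lam by move=> p q /Pinj[].
have [kap [kinj kP]] : exists kappa : nat -> nat, injective kappa /\
    forall j s, uniq s -> j \notin s ->
      \sum_(k <- s) a (lam (kappa j)) (lam (kappa k)) <= e.
  apply: (IH (fun p q => a (lam p) (lam q))) => p t ut.
  have [us jns hs] := hjs p.
  have := ae (lam p) ([seq lam q | q <- t] ++ [seq P p k | k <- (js p).2]).
  rewrite big_cat/= !big_map mulrS => h.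
  rewrite -(lerD2l e); apply: le_trans (h _).
    by rewrite addrC; apply: lerD => //; exact: ltW.
  rewrite cat_uniq !map_inj_uniq// ?ut ?us => [|k l /Pinj[]//]; rewrite andbT /=.
  apply/hasPn => _ /mapP[k kjs ->]; apply/mapP => -[q _ /Pinj[pq kE]].
  by move: jns; rewrite pq -kE -pq kjs.
by exists (lam \o kap); split=> //; exact: inj_comp.
Qed.

Lemma rosenthal (a : nat -> nat -> R) (c e : R) : 0 < e ->
  (forall j s, uniq s -> \sum_(k <- s) a j k <= c) ->
  exists kappa : nat -> nat, injective kappa /\
    forall j s, uniq s -> j \notin s -> \sum_(k <- s) a (kappa j) (kappa k) <= e.
Proof.
move=> e0 ac; apply: (@rosenthal_bounded e (Num.bound (`|c| / e))).
  exact: ltW.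
move=> j s us; apply: le_trans (ac _ _ us) _; apply: le_trans (ler_norm _) _.
rewrite -mulr_natl -ler_pdivrMr//; apply/ltW/archi_boundP.
by rewrite divr_ge0// ltW.
Qed.

End Rosenthal.

(** * Disjoint families in infinite dimensional lattices *)

Section DisjointFamilies.
Context {R : realType} {X : banachLatticeType R}.
Implicit Types (x y z u v : X) (s : seq X).

Definition ldisjoint x y : bool := lmeet x y == 0.

Lemma lmeetC x y : lmeet x y = lmeet y x.
Proof. by apply/lle_anti; rewrite !lle_meetr !lmeet_lel !lmeet_ler. Qed.

Lemma ldisjointC x y : ldisjoint x y = ldisjoint y x.
Proof. by rewrite /ldisjoint lmeetC. Qed.

Lemma ldisjoint_le x y x' y' : 0 <=l x' -> 0 <=l y' -> x' <=l x -> y' <=l y ->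
  ldisjoint x y -> ldisjoint x' y'.
Proof.
move=> x0 y0 xx yy /eqP xy; apply/eqP/lle_anti; rewrite lle_meetr x0 y0 andbT.
rewrite -xy lle_meetr (lle_trans (lmeet_lel _ _) xx).
by rewrite (lle_trans (lmeet_ler _ _) yy).
Qed.

Lemma ldisjointZ (a b : R) x y : 0 <= a -> 0 <= b -> 0 <=l x -> 0 <=l y ->
  ldisjoint x y -> ldisjoint (a *: x) (b *: y).
Proof.
move=> a0 b0 x0 y0 /eqP xy.
have m0 : 0 < a + b + 1 by rewrite ltr_wpDl// addr_ge0.
pose w := lmeet (a *: x) (b *: y).
have w0 : 0 <=l w by rewrite lle_meetr !lscale_ge0.
have h (t : R) z : 0 <= t -> t <= a + b + 1 -> 0 <=l z -> w <=l t *: z ->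
    (a + b + 1)^-1 *: w <=l z.
  move=> t0 tm z0 wz; have := lleZ2l (a := (a + b + 1)^-1) _ wz.
  rewrite invr_ge0 ltW// => /(_ isT)/lle_trans; apply.
  rewrite scalerA -lsubr_ge0 -{1}[z]scale1r -scalerBl lscale_ge0// subr_ge0.
  by rewrite mulrC ler_pdivrMr// mul1r.
have : (a + b + 1)^-1 *: w = 0.
  apply/lle_anti; rewrite lscale_ge0 ?invr_ge0 ?(ltW m0)// andbT -xy lle_meetr.
  by rewrite (h a)// ?lmeet_lel// ?(h b)// ?lmeet_ler//; lra.
move/eqP; rewrite scaler_eq0 invr_eq0 gt_eqF//=.
Qed.

Lemma ldisjointD x y z : 0 <=l x -> 0 <=l y -> 0 <=l z ->
  ldisjoint x y -> ldisjoint x z -> ldisjoint x (y + z).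
Proof.
move=> x0 y0 z0 /eqP xy /eqP xz; pose w := lmeet x (y + z).
have w0 : 0 <=l w by rewrite lle_meetr x0 laddr_ge0.
have [w1 [w2 [wE w10 w1y w20 w2z]]] := riesz_decomp y0 z0 w0 (lmeet_ler _ _).
have wx : w <=l x by exact: lmeet_lel.
have w1_0 : w1 = 0.
  apply/lle_anti; rewrite w10 andbT -xy lle_meetr w1y andbT.
  by apply: lle_trans wx; rewrite wE -{1}[w1]addr0 lleD.
have w2_0 : w2 = 0.
  apply/lle_anti; rewrite w20 andbT -xz lle_meetr w2z andbT.
  by apply: lle_trans wx; rewrite wE -{1}[w2]add0r lleD.
by apply/eqP; rewrite -/w wE w1_0 w2_0 addr0.
Qed.

Lemma ldisjoint_lneg_lpos x : ldisjoint (lpos x) (lneg x).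
Proof. by rewrite ldisjointC /ldisjoint lmeet_lpos_lneg. Qed.

Lemma labs_disjointD x y : 0 <=l x -> ldisjoint x (labs y) ->
  labs (x + y) = x + labs y.
Proof.
move=> x0 /eqP; rewrite lmeetE => /eqP; rewrite subr_eq0 => /eqP h.
have h' : lneg (labs y - x) = x.
  have := lpos_lneg (labs y - x); rewrite -h => /(congr1 (fun z => labs y - z)).
  by rewrite !opprB ![labs y + _]addrC !subrK.
have E : labs (labs y - x) = x + labs y.
  by rewrite labs_lpos_lneg -h h' addrC.
apply/lle_anti/andP; split.
  by apply: lle_trans (labsD _ _) _; rewrite ger0_labs.
rewrite -E labs_le; apply/andP; split; rewrite ?opprB lle_subl.
  have -> : y = (x + y) - x by rewrite addrC addKr.
  apply: lle_trans (labsD _ _) _; rewrite labsN (ger0_labs x0).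
  by rewrite [x + _ - x]addrC addKr.
have {1}-> : x = (x + y) - y by rewrite addrK.
apply: lle_trans (le_labs _) _; apply: lle_trans (labsD _ _) _.
by rewrite labsN.
Qed.

(** The multiples of [x] below [z] are bounded in norm and the cone is
    closed. *)
Lemma max_multiple x z : 0 <=l x -> x != 0 -> 0 <=l z ->
  exists t : R, [/\ 0 <= t, t *: x <=l z & forall r, r *: x <=l z -> r <= t].
Proof.
move=> x0 xn0 z0; pose A := [set t : R | t *: x <=l z].
have nx : 0 < `|x| by rewrite normr_gt0.
have A0 : A 0 by rewrite /A/= scale0r.
have ubA t : A t -> t <= `|z| / `|x|.
  move=> At; rewrite ler_pdivlMr//; have [t0|t0] := leP 0 t.
    rewrite -[t in leLHS]ger0_norm// -normrZ.
    by apply: ler0_norm_le At; rewrite lscale_ge0.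
  by rewrite (le_trans _ (normr_ge0 _))// pmulr_lle0// ltW.
have hA : has_sup A by split; [exists 0|exists (`|z| / `|x|)].
have supA r : A r -> r <= sup A by move=> Ar; apply: ub_le_sup; [exact: hA.2|].
exists (sup A); split; [exact: supA| |exact: supA].
rewrite -lsubr_ge0; apply: lcone_closed => e e0.
have ex : 0 < e / `|x| by rewrite divr_gt0.
have [t At ht] := sup_adherent ex hA.
exists (z - t *: x); first by rewrite lsubr_ge0.
rewrite opprB addrC addrA addrNK -scalerBl normrZ -ler_pdivlMr// ger0_norm.
  by rewrite lerBlDr -lerBlDl ltW.
by rewrite subr_ge0 supA.
Qed.

(** Stated through disjointness, which is what the maximality of a disjoint
    family yields; by [latom_multiple] the interval below such an [x] consists
    of multiples of [x]. *)
Definition latom x : Prop := [/\ 0 <=l x, x != 0 & forall u v, 0 <=l u ->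
  0 <=l v -> u <=l x -> v <=l x -> ldisjoint u v -> u = 0 \/ v = 0].

(** The positive and negative parts of [y - r *: x] are disjoint and, after
    scaling, below [x]; hence one of them vanishes. *)
Lemma latom_total x y (r : R) : latom x -> 0 <=l y -> y <=l x -> 0 <= r ->
  y <=l r *: x \/ r *: x <=l y.
Proof.
move=> [x0 xn0 xat] y0 yx r0; pose m : R := (1 + r)^-1.
have r1 : 0 < 1 + r by lra.
have m0 : 0 < m by rewrite invr_gt0.
have yr : y <=l (1 + r) *: x.
  by rewrite scalerDl scale1r (lle_trans yx)// -{1}[x]addr0 lleD// lscale_ge0.
have rr : r *: x <=l (1 + r) *: x.
  by rewrite scalerDl scale1r -{1}[r *: x]add0r lleD.
have p1 : m *: lpos (y - r *: x) <=l x.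
  rewrite -[X in _ <=l X]scale1r -(mulVf (lt0r_neq0 r1)) -scalerA lleZ2l ?(ltW m0)//.
  rewrite lle_joinl lscale_ge0// ?(ltW r1)// andbT (lle_trans _ yr)// lle_subr//.
  by rewrite lscale_ge0.
have n1 : m *: lneg (y - r *: x) <=l x.
  rewrite -[X in _ <=l X]scale1r -(mulVf (lt0r_neq0 r1)) -scalerA lleZ2l ?(ltW m0)//.
  rewrite lle_joinl lscale_ge0// ?(ltW r1)// andbT opprB (lle_trans _ rr)//.
  exact: lle_subr.
have := xat _ _ _ _ p1 n1; rewrite !lscale_ge0 ?lpos_ge0 ?lneg_ge0 ?(ltW m0)//.
have -> : ldisjoint (m *: lpos (y - r *: x)) (m *: lneg (y - r *: x)).
  by apply: ldisjointZ; rewrite ?(ltW m0) ?lpos_ge0 ?lneg_ge0 ?ldisjoint_lneg_lpos.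
case=> // /eqP; rewrite scaler_eq0 gt_eqF//= => /eqP h; [left|right].
  by have := le_lpos (y - r *: x); rewrite h lle_subl add0r.
have := le_lpos (- (y - r *: x)); rewrite -[lpos _]/(lneg _) h opprB.
by rewrite lle_subl add0r.
Qed.

(** With [t] maximal such that [t *: x <= y], [latom_total] gives
    [y <= (t + e) *: x] for every positive [e]. *)
Lemma latom_multiple x y : latom x -> 0 <=l y -> y <=l x -> exists t, y = t *: x.
Proof.
move=> xat y0 yx; have [x0 xn0 _] := xat.
have [t [t0 tx tmax]] := max_multiple x0 xn0 y0.
exists t; apply/eqP; rewrite -subr_eq0; apply/eqP; apply: norm_le_all_eq0 => e e0.
have nx : 0 < `|x| by rewrite normr_gt0.
have ex : 0 < e / `|x| by rewrite divr_gt0.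
have te : 0 <= t + e / `|x| by rewrite addr_ge0// ltW.
have [h|/tmax] := latom_total xat y0 yx te; last lra.
apply: (@le_trans _ _ `|(e / `|x|) *: x|).
  apply: ler0_norm_le; first by rewrite lsubr_ge0.
  by rewrite lle_subl -scalerDl addrC.
by rewrite normrZ ger0_norm ?(ltW ex)// divfK// gt_eqF.
Qed.

Definition in_span s z : Prop :=
  exists c : nat -> R, z = \sum_(i < size s) c i *: nth 0 s i.

Lemma in_span_nil : in_span [::] 0.
Proof. by exists (fun=> 0); rewrite big_ord0. Qed.

Lemma in_span_cons (t : R) x s z : in_span s (z - t *: x) -> in_span (x :: s) z.
Proof.
move=> [c cE]; exists (fun i => if i is i'.+1 then c i' else t).
by rewrite big_ord_recl/= -cE addrC subrK.
Qed.

Lemma in_spanB s z z' : in_span s z -> in_span s z' -> in_span s (z - z').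
Proof.
move=> [c ->] [c' ->]; exists (fun i => c i - c' i).
by rewrite -sumrB; apply: eq_bigr => i _; rewrite scalerBl.
Qed.

Lemma in_span_finite s : (forall z, in_span s z) -> ~ infinite_dimensional X.
Proof.
move=> h; apply; exists (size s), (fun i => nth 0 s i) => z _.
by have [c cE] := h z; exists (fun i => c i).
Qed.

Definition disjoint_family s : bool :=
  all (fun x => (0 <=l x) && (x != 0)) s && pairwise ldisjoint s.

(** If [x] had two nonzero disjoint parts, replacing it by them would enlarge
    the family. *)
Lemma disjoint_family_atoms s : disjoint_family s ->
  (forall s', disjoint_family s' -> (size s' <= size s)%N) ->
  forall x, x \in s -> latom x.
Proof.
move=> /andP[/allP spos sdis] smax x xs; have /andP[x0 xn0] := spos _ xs.
split=> // u v u0 v0 ux vx uv; apply: contrapT => /not_orP[/eqP un0 /eqP vn0].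
case/splitPr: xs spos sdis smax => s1 s2 spos.
rewrite pairwise_cat allrel_consr pairwise_cons => /and3P[/andP[s1x s12] ps1].
move=> /andP[xs2 ps2] smax.
have dis w : 0 <=l w -> w <=l x -> all (ldisjoint w) (s1 ++ s2).
  move=> w0 wx; rewrite all_cat; apply/andP; split; apply/allP => y ys.
    have y0 : 0 <=l y by have /andP[] := spos y ltac:(by rewrite mem_cat ys).
    apply: ldisjoint_le wx (lle_refl _) _ => //.
    by rewrite ldisjointC; exact: (allP s1x).
  have y0 : 0 <=l y by have /andP[] := spos y ltac:(by rewrite mem_cat inE ys !orbT).
  by apply: ldisjoint_le wx (lle_refl _) _ => //; exact: (allP xs2).
have /smax : disjoint_family (u :: v :: s1 ++ s2).
  rewrite /disjoint_family /= u0 un0 v0 vn0 uv !dis//= pairwise_cat s12 ps1 ps2.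
  rewrite !andbT; apply/allP => y; rewrite mem_cat => ys; apply: spos.
  by rewrite mem_cat inE orbCA ys orbT.
by rewrite /= !size_cat/= addnS ltnn.
Qed.

(** Subtract from [z] its largest multiple of each atom in turn. *)
Lemma disjoint_family_project s z : (forall x, x \in s -> latom x) ->
  pairwise ldisjoint s -> 0 <=l z ->
  exists r, [/\ 0 <=l r, r <=l z, all (ldisjoint r) s & in_span s (z - r)].
Proof.
elim: s z => [|x s IH] z sat /=.
  by exists z; split=> //; rewrite subrr; exact: in_span_nil.
move=> /andP[xs ps] z0; have xat := sat x (mem_head _ _); have [x0 xn0 _] := xat.
have [t [t0 tz tmax]] := max_multiple x0 xn0 z0.
have zt0 : 0 <=l z - t *: x by rewrite lsubr_ge0.
have [|r [r0 rz rs [c cE]]] := IH (z - t *: x) _ ps zt0.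
  by move=> y ys; apply: sat; rewrite inE ys orbT.
exists r; split=> //.
- by apply: lle_trans rz _; apply: lle_subr; rewrite lscale_ge0.
- rewrite rs andbT; apply: (ldisjoint_le r0 x0 rz (lle_refl _)); apply/eqP.
  have w0 : 0 <=l lmeet (z - t *: x) x by rewrite lle_meetr zt0.
  have [d wE] := latom_multiple xat w0 (lmeet_ler _ _).
  have dx : (t + d) *: x <=l z.
    rewrite scalerDl -wE -lsubr_ge0 opprD addrA lsubr_ge0.
    exact: lmeet_lel.
  have d0 : d <= 0 by have := tmax _ dx; lra.
  apply/lle_anti; rewrite w0 andbT wE -[d]opprK scaleNr loppr_le0.
  by rewrite lscale_ge0// oppr_ge0.
- by apply: (@in_span_cons t); exists c; rewrite -cE addrAC.
Qed.

(** If no disjoint family is larger than [s], then the members of [s] are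
    atoms, and by maximality the part of a positive [z] disjoint from all of
    them is zero; so [s] spans the space. *)
Lemma disjoint_family_exists n : infinite_dimensional X ->
  exists2 s, size s = n & disjoint_family s.
Proof.
move=> Xinf; elim: n => [|n [s sn sd]]; first by exists [::].
apply: contrapT => hn.
have smax s' : disjoint_family s' -> (size s' <= size s)%N.
  move=> s'd; rewrite sn leqNgt; apply/negP => ns'; apply: hn.
  exists (take n.+1 s'); first by rewrite size_takel.
  move: s'd; rewrite -{1}(cat_take_drop n.+1 s') /disjoint_family all_cat.
  by rewrite pairwise_cat => /andP[/andP[-> _] /and3P[_ ->]].
have sat := disjoint_family_atoms sd smax.
have /andP[_ ps] := sd.
have pos z : 0 <=l z -> in_span s z.
  move=> z0; have [r [r0 _ rs zr]] := disjoint_family_project sat ps z0.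
  have [r_0|rn0] := eqVneq r 0; first by rewrite r_0 subr0 in zr.
  have /smax : disjoint_family (r :: s).
    by rewrite /disjoint_family/= r0 rn0 rs.
  by rewrite /= ltnn.
apply: (@in_span_finite s) => // z; rewrite [z]lpos_lneg.
by apply: in_spanB; apply: pos; rewrite ?lpos_ge0 ?lneg_ge0.
Qed.

End DisjointFamilies.

(** * Functionals that are small in the mean *)

Section SpreadFunctionals.
Context {R : realType} {F : banachLatticeType R}.
Implicit Types (g h : dual F) (gs : seq (dual F)) (y : F).

(** A finite family of functionals has a common kernel of finite codimension;
    each functional that does not vanish on the common kernel of the previous
    ones costs one more vector in [s]. *)
Lemma common_kernel gs : exists s : seq F, forall y, exists r,
  in_span s (y - r) /\ forall g, g \in gs -> g r = 0.
Proof.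
elim: gs => [|g gs [s IH]].
  by exists [::] => y; exists y; split=> //; rewrite subrr; exact: in_span_nil.
have [[r0 r0gs gr0]|hn] :=
    pselect (exists2 r0, forall h, h \in gs -> h r0 = 0 & g r0 != 0 :> R).
  exists (r0 :: s) => y; have [r [yr rgs]] := IH y.
  pose t : R := g r / g r0; exists (r - t *: r0); split.
    apply: (@in_span_cons _ _ t).
    by rewrite opprB addrA addrAC addrK.
  move=> h; rewrite inE linearB linearZ/= => /predU1P[->|hgs].
    by rewrite -[LHS]/(g r - t * g r0) divfK// subrr.
  by rewrite rgs// r0gs// scaler0 subrr.
exists s => y; have [r [yr rgs]] := IH y; exists r; split=> // h.
rewrite inE => /predU1P[->|]; last exact: rgs.
by apply/eqP/negP => /negP gr; apply: hn; exists r.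
Qed.

Lemma infinite_dimensional_dual :
  infinite_dimensional F -> infinite_dimensional (dual F).
Proof.
move=> Finf [n [v vP]]; have [s sP] := common_kernel [seq v i | i <- enum 'I_n].
apply: (in_span_finite (s := s)) Finf => y; have [r [yr rv]] := sP y.
suff r0 : r = 0 by move: yr; rewrite r0 subr0.
have [f [_ fr]] := norming_functional r; apply/eqP; rewrite -normr_eq0 -fr.
have [c ->] := vP f I; apply/eqP.
have -> : (\sum_(i < n) c i *: v i) r = eval r (\sum_(i < n) c i *: v i) by [].
rewrite linear_sum big1// => i _; rewrite linearZ/=.
by rewrite rv ?scaler0// map_f// mem_enum.
Qed.

Lemma dual_sumE (I : Type) (s : seq I) (g : I -> dual F) y :
  (\sum_(i <- s) g i) y = \sum_(i <- s) g i y :> R.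
Proof.
by elim: s => [|i s IH]; rewrite ?big_nil// !big_cons dualDE IH.
Qed.

(** A list with multiplicities, so that the mean over all choices of signs is
    a sum over it divided by its size. *)
Fixpoint signed_sums gs : seq (dual F) :=
  if gs is g :: gs' then
    [seq g + h | h <- signed_sums gs'] ++ [seq h - g | h <- signed_sums gs']
  else [:: 0].

Lemma size_signed_sums gs : size (signed_sums gs) = (2 ^ size gs)%N.
Proof.
by elim: gs => //= g gs IH; rewrite size_cat !size_map IH expnS mul2n addnn.
Qed.

Lemma sum_ge0 gs : all (fun g => 0 <=l g) gs -> 0 <=l \sum_(g <- gs) g.
Proof.
elim: gs => [|g gs IH]; first by rewrite big_nil.
by move=> /andP[g0 /IH]; rewrite big_cons; exact: laddr_ge0.
Qed.

(** The modulus is additive on disjoint vectors, and so it does not see the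
    signs. *)
Lemma labs_signed_sums gs h : all (fun g => 0 <=l g) gs -> pairwise ldisjoint gs ->
  h \in signed_sums gs -> labs h = \sum_(g <- gs) g.
Proof.
elim: gs h => [|g gs IH] h.
  by move=> _ _; rewrite inE => /eqP ->; rewrite labs0 big_nil.
move=> /andP[g0 gs0] /=/andP[ggs pgs]; rewrite big_cons.
have dis : ldisjoint g (\sum_(k <- gs) k).
  elim: gs {IH pgs} gs0 ggs => [|k gs IH].
    move=> _ _; rewrite big_nil; apply/eqP/lle_anti.
    by rewrite lmeet_ler lle_meetr g0 lle_refl.
  move=> /andP[k0 gs0] /andP[gk ggs]; rewrite big_cons.
  by apply: ldisjointD; rewrite ?sum_ge0 ?IH.
rewrite mem_cat => /orP[] /mapP[k kgs ->].
  by rewrite labs_disjointD// IH.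
by rewrite -labsN opprB labs_disjointD ?labsN// IH.
Qed.

Lemma sum_signed_const gs (a : R) :
  \sum_(h <- signed_sums gs) a = (2 ^ size gs)%:R * a.
Proof.
by rewrite big_const_seq count_predT size_signed_sums iter_addr_0 mulr_natl.
Qed.

(** Orthogonality of independent signs: the mixed terms cancel between [g + h]
    and [h - g]. *)
Lemma sum_sqr_signed_sums gs y :
  \sum_(h <- signed_sums gs) (h y : R) ^+ 2 =
  (2 ^ size gs)%:R * \sum_(g <- gs) (g y : R) ^+ 2.
Proof.
have E (a b : R) : (a + b) ^+ 2 + (b - a) ^+ 2 = 2 * a ^+ 2 + 2 * b ^+ 2 by lra.
elim: gs => [|g gs IH]; first by rewrite /= big_seq1 big_nil expr0n mulr0.
rewrite /= big_cat/= !big_map -big_split/= big_cons.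
have -> : \sum_(h <- signed_sums gs) ((((g + h) y : R) ^+ 2) + ((h - g) y : R) ^+ 2)
  = \sum_(h <- signed_sums gs) (2 * (g y : R) ^+ 2 + 2 * (h y : R) ^+ 2).
  by apply: eq_bigr => h _; exact: E.
rewrite big_split/= sum_signed_const -mulr_sumr IH expnS natrM.
by rewrite mulrDr !mulrA [_ * 2]mulrC.
Qed.

Lemma sum_abs_le_sum gs y : all (fun g => 0 <=l g) gs ->
  \sum_(g <- gs) `|g y| <= `|\sum_(g <- gs) g| * `|y|.
Proof.
move=> /allP gs0; rewrite -(norm_labs y).
apply: le_trans (le_trans (ler_norm _) (ler_dual (\sum_(g <- gs) g) (labs y))).
rewrite dual_sumE big_seq [leRHS]big_seq; apply: ler_sum => g /gs0 g0.
by apply: le_trans (ler_dual_labs g y) _; rewrite (ger0_labs g0).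
Qed.

Lemma norming_vector_half h : 1 <= `|h| -> exists v : F, `|v| <= 1 /\ 2^-1 <= h v :> R.
Proof.
move=> h1; have [||v v1 hv] := @norming_vector _ _ h 2^-1.
- by rewrite invr_ge0.
- by apply: lt_le_trans h1; rewrite invf_lt1// ltr1n.
by exists v; split=> //; exact: ltW.
Qed.

Lemma attach_norming gs : (forall g, g \in gs -> `|g| = 1) ->
  exists L : seq (dual F * F), [seq p.1 | p <- L] = gs /\
    forall p, p \in L -> [/\ `|p.1| <= 1, `|p.2| <= 1 & 2^-1 <= p.1 p.2 :> R].
Proof.
elim: gs => [|g gs IH] gs1; first by exists [::].
have [|L [LE LP]] := IH; first by move=> h hgs; apply: gs1; rewrite inE hgs orbT.
have g1 := gs1 g (mem_head _ _).
have [|v [v1 gv]] := @norming_vector_half g; first by rewrite g1.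
exists ((g, v) :: L); rewrite /= LE; split=> // p.
by rewrite inE => /predU1P[->|/LP//]; rewrite g1.
Qed.

Lemma normalized_disjoint_functionals n : infinite_dimensional F ->
  exists gs, [/\ size gs = n, all (fun g => 0 <=l g) gs, pairwise ldisjoint gs &
    forall g, g \in gs -> `|g| = 1].
Proof.
move=> /infinite_dimensional_dual /(disjoint_family_exists n)[s sn /andP[/allP sp sd]].
have n0 g : g \in s -> g != 0 by move=> /sp/andP[].
exists [seq `|g|^-1 *: g | g <- s]; rewrite size_map; split=> //.
- rewrite all_map; apply/allP => g /sp/andP[g0 _] /=.
  by rewrite lscale_ge0// invr_ge0.
- elim: s {sn n0} sp sd => //= g s IH sp /andP[gs ps].
  rewrite all_map IH ?andbT//; last by move=> h hs; apply: sp; rewrite inE hs orbT.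
  apply/allP => h hs /=.
  have /andP[g0 _] := sp g (mem_head _ _).
  have /andP[h0 _] := sp h ltac:(by rewrite inE hs orbT).
  by apply: ldisjointZ; rewrite ?invr_ge0//; exact: (allP gs).
- move=> _ /mapP[g gs ->]; rewrite normrZ normfV normr_id mulVf//.
  by rewrite normr_eq0 n0.
Qed.

(** A Josefson-Nissenzweig theorem in the mean.  Take [n] disjoint positive
    functionals of norm one and let [M] be the norm of their sum.  If [M] is
    bounded while [n] is large, then the functionals themselves will do, since
    the sum of the values [`|g y|] is at most [M * `|y|].  If [M] is large,
    then all their signed sums have norm [M]; divided by [M] they have norm
    one, and by orthogonality of the signs their mean at [y] is of order
    [`|y| / sqrt M]. *)
Lemma spread_functionals (e : R) : 0 < e -> infinite_dimensional F ->
  exists L : seq (dual F * F), [/\ L != [::],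
    forall p, p \in L -> [/\ `|p.1| <= 1, `|p.2| <= 1 & 2^-1 <= p.1 p.2 :> R] &
    forall y, \sum_(p <- L) `|p.1 y| <= e * (size L)%:R * `|y|].
Proof.
move=> e0 Finf; pose K : R := e^-1 * e^-1.
have K0 : 0 < K by rewrite mulr_gt0 ?invr_gt0.
pose n := Num.bound (K / e).
have nK : K / e < n%:R by apply: archi_boundP; rewrite divr_ge0// ltW.
have [gs [sgs gs0 pgs gs1]] := normalized_disjoint_functionals n Finf.
pose M := `|\sum_(g <- gs) g|.
have [MK|KM] := ltP M K.
  have [L [LE LP]] := attach_norming gs1.
  have sL : size L = n by rewrite -sgs -LE size_map.
  exists L; split=> // [|y].
    apply/negP => /eqP L0; move: nK; rewrite -sL L0/=.
    by rewrite ltNge divr_ge0// ltW.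
  have -> : \sum_(p <- L) `|p.1 y| = \sum_(g <- gs) `|g y|.
    by rewrite -LE big_map.
  apply: le_trans (sum_abs_le_sum _ gs0) _; rewrite ler_wpM2r// sL.
  rewrite (le_trans (ltW MK))// -ler_pdivrMl//.
  by rewrite mulrC ltW.
have M0 : 0 < M by exact: lt_le_trans KM.
have [|L [LE LP]] := @attach_norming [seq M^-1 *: h | h <- signed_sums gs].
  move=> _ /mapP[h hgs ->]; rewrite normrZ ger0_norm ?invr_ge0 ?(ltW M0)//.
  by rewrite -(norm_labs h) (labs_signed_sums gs0 pgs hgs) mulVf ?gt_eqF.
have sL : size L = (2 ^ n)%N.
  by rewrite -sgs -size_signed_sums -(size_map (fun h => M^-1 *: h)) -LE size_map.
exists L; split=> // [|y].
  by rewrite -size_eq0 sL expn_eq0.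
have -> : \sum_(p <- L) `|p.1 y| = M^-1 * \sum_(h <- signed_sums gs) `|h y|.
  have -> : \sum_(p <- L) `|p.1 y| = \sum_(g <- [seq p.1 | p <- L]) `|g y|.
    by rewrite big_map.
  rewrite LE big_map mulr_sumr; apply: eq_bigr => h _.
  by rewrite -[(M^-1 *: h) y]/(M^-1 * h y) normrM ger0_norm// invr_ge0 ltW.
have [->|y0] := eqVneq y 0.
  rewrite normr0 mulr0 big1 ?mulr0// => h _; by rewrite linear0 normr0.
have ny : 0 < `|y| by rewrite normr_gt0.
(* The quadratic mean is used in the form [2 * `|a| <= t + a ^+ 2 / t], which
   needs no square root; this [t] balances both terms. *)
pose t := e * M * `|y|.
have t0 : 0 < t by rewrite !mulr_gt0.
have am (a : R) : `|a| <= 2^-1 * (t + t^-1 * a ^+ 2).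
  have h : 0 <= (`|a| - t) ^+ 2 by exact: sqr_ge0.
  rewrite sqrrB real_normK ?num_real// in h.
  suff : t * (2 * `|a|) <= t * (t + t^-1 * a ^+ 2) by rewrite ler_pM2l//; lra.
  by rewrite mulrDr mulVKf ?gt_eqF//; lra.
have sq : \sum_(g <- gs) (g y : R) ^+ 2 <= `|y| * (M * `|y|).
  apply: le_trans (_ : `|y| * \sum_(g <- gs) `|g y| <= _); last first.
    by rewrite ler_wpM2l// sum_abs_le_sum.
  rewrite mulr_sumr big_seq [leRHS]big_seq; apply: ler_sum => g /gs1 g1.
  rewrite -real_normK ?num_real// expr2 ler_wpM2r//.
  by have := ler_dual g y; rewrite g1 mul1r.
have s1 : \sum_(h <- signed_sums gs) `|h y| <=
    2^-1 * ((2 ^ n)%:R * t + t^-1 * ((2 ^ n)%:R * (`|y| * (M * `|y|)))).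
  apply: (@le_trans _ _ (\sum_(h <- signed_sums gs) 2^-1 * (t + t^-1 * (h y : R) ^+ 2))).
    by apply: ler_sum => h _; exact: am.
  rewrite -mulr_sumr ler_wpM2l ?invr_ge0// big_split/=.
  rewrite sum_signed_const -mulr_sumr sum_sqr_signed_sums sgs lerD2l.
  rewrite ler_wpM2l ?invr_ge0 ?(ltW t0)//.
  by rewrite ler_wpM2l.
rewrite sL mulrC -ler_pdivlMr ?invr_gt0// invrK; apply: le_trans s1 _.
have E (N a b c : R) : a != 0 -> b != 0 -> c != 0 ->
    (a * b * c)^-1 * (N * (c * (b * c))) = N * (a^-1 * c).
  by move=> a0 b0 c0; field; rewrite a0 b0 c0.
rewrite /t E ?gt_eqF//.
have E2 (N a b c : R) : N * (b * c) <= N * (a * M * c) ->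
    2^-1 * (N * (a * M * c) + N * (b * c)) <= a * N * c * M by lra.
apply: E2; rewrite ler_wpM2l// ler_wpM2r//.
by rewrite -ler_pdivrMl.
Qed.

End SpreadFunctionals.

(** * The first factor is a KB-space *)

Section WittstockKB.
Context {R : realType}.

(** The [x k] are increments of an increasing bounded sequence.  Moduli of
    norming functionals form with them a matrix with bounded row sums, whose
    off-diagonal part [rosenthal] makes small along some of the indices. *)
Lemma not_kb_biorthogonal (E : banachLatticeType R) : ~ kb_space E ->
  exists (x : nat -> E) (f : nat -> dual E) (c d : R), [/\ 0 < d,
    forall k, 0 <=l x k /\ d <= f k (x k) :> R,
    forall k, 0 <=l f k /\ `|f k| <= 1,
    forall t, uniq t -> `|\sum_(k <- t) x k| <= c &
    forall j t, uniq t -> j \notin t -> \sum_(k <- t) f j (x k) <= d / 4].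
Proof.
move=> /not_kb_space[s [c [d [d0 s0 incr sc sd]]]].
pose x k := s k.+1 - s k.
have x0 k : 0 <=l x k by rewrite lsubr_ge0.
have sumx0 t : 0 <=l \sum_(k <- t) x k.
  by elim/big_ind: _ => // y z; exact: laddr_ge0.
have sumx t : uniq t -> `|\sum_(k <- t) x k| <= c.
  move=> ut; pose N := (\max_(k <- t) k).+1.
  have tN k : k \in t -> (k < N)%N by move=> kt; rewrite ltnS (leq_bigmax_seq k).
  have pt : perm_eq t [seq k <- iota 0 N | k \in t].
    apply: uniq_perm => //; first by rewrite filter_uniq// iota_uniq.
    move=> k; rewrite mem_filter mem_iota add0n leq0n /=.
    by case kt: (k \in t) => //=; rewrite tN.
  apply: le_trans (sc N); apply: ler0_norm_le; first exact: sumx0.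
  rewrite (perm_big _ pt) big_filter.
  apply: (@lle_trans _ _ (\sum_(k <- iota 0 N) x k)).
    rewrite [X in _ <=l X](bigID (mem t))/= -[X in X <=l _]addr0 lleD//.
    by elim/big_ind: _ => // y z; exact: laddr_ge0.
  have -> : \sum_(k <- iota 0 N) x k = s N - s 0%N.
    by rewrite -[iota 0 N]/(index_iota 0 N) telescope_sumr.
  exact: lle_subr.
have /choice[f fP] k : exists f : dual E, [/\ 0 <=l f, `|f| <= 1 & d <= f (x k) :> R].
  have [f [f1 fx]] := norming_functional (x k).
  exists (labs f); rewrite labs_ge0 norm_labs; split=> //.
  apply: le_trans (sd k) _; rewrite -[s k.+1 - s k]/(x k) -fx.
  exact: ((dleP _ _).1 (le_labs f)).
have row j t : uniq t -> \sum_(k <- t) f j (x k) <= c.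
  move=> ut; have -> : \sum_(k <- t) f j (x k) = f j (\sum_(k <- t) x k) :> R.
    by rewrite linear_sum.
  apply: le_trans (ler_norm _) _; apply: le_trans (ler_dual _ _) _.
  have [_ fj1 _] := fP j.
  by rewrite -[c]mul1r; apply: ler_pM => //; exact: sumx.
have d4 : 0 < d / 4 by rewrite divr_gt0.
have [kap [kinj kP]] := @rosenthal _ (fun j k => f j (x k)) c _ d4 row.
exists (x \o kap), (f \o kap), c, d; split=> //= [k|k|t ut].
- by have [] := fP (kap k).
- by have [] := fP (kap k).
- by rewrite -(big_map kap xpredT x) sumx// map_inj_uniq.
Qed.

Context {E F : banachLatticeType R}.

Definition wavg (r : seq (dual E * dual F)) : dual (wtensor E F) :=
  (size r)%:R^-1 *: \sum_(p <- r) wdual p.1 p.2.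

Lemma wavgE r T : wavg r T = (size r)%:R^-1 * \sum_(p <- r) p.2 (T p.1) :> R.
Proof.
rewrite -[LHS]/((size r)%:R^-1 * (\sum_(p <- r) wdual p.1 p.2) T).
congr (_ * _); elim: r => [|p r IH]; first by rewrite !big_nil.
by rewrite !big_cons -IH.
Qed.

Lemma wavg_norm r : (forall p, p \in r -> `|p.1| <= 1 /\ `|p.2| <= 1) ->
  `|wavg r| <= 1.
Proof.
move=> r1; have [->|rn0] := eqVneq r [::].
  by rewrite /wavg big_nil scaler0 normr0.
have r0 : 0 < (size r)%:R :> R by rewrite ltr0n lt0n size_eq0.
rewrite /wavg normrZ ger0_norm ?invr_ge0 ?(ltW r0)// ler_pdivrMl// mulr1.
apply: le_trans (ler_norm_sum _ _ _) _.
rewrite -sum1_size natr_sum big_seq [leRHS]big_seq; apply: ler_sum => p /r1[p1 p2].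
by apply: le_trans (wdual_norm _ _) _; rewrite -[leRHS]mul1r ler_pM.
Qed.

(** The pairs [(n, i)], encoded as natural numbers by [ix], index the
    biorthogonal system, so that the families [L n] of [spread_functionals]
    use disjoint blocks of it.  In [psi n (U N)] the diagonal terms contribute
    at least [d / 2] on average, and the off-diagonal ones at most [d / 4] in
    absolute value. *)
Lemma grothendieck_kb : infinite_dimensional F ->
  grothendieck (wtensor E F) -> kb_space E.
Proof.
move=> Finf GW; apply: contrapT => nkb.
have [x [f [c [d [d0 x0 f0 sumx off]]]]] := not_kb_biorthogonal nkb.
have en n : 0 < n.+1%:R^-1 :> R by rewrite invr_gt0.
have /choice[L LP] n := spread_functionals (en n) Finf.
pose pt n i : dual F * F := nth (0, 0) (L n) i.
pose ix (n i : nat) : nat := pickle (n, i).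
have ix_inj : injective (fun p : nat * nat => ix p.1 p.2).
  by move=> [n i] [n' i'] /(pcan_inj pickleK).
have ptP n i : (i < size (L n))%N ->
    [/\ `|(pt n i).1| <= 1, `|(pt n i).2| <= 1 & 2^-1 <= (pt n i).1 (pt n i).2 :> R].
  by move=> iL; have [_ h _] := LP n; apply: h; exact: mem_nth.
pose r n := [seq (f (ix n i), (pt n i).1) | i <- iota 0 (size (L n))].
have sr n : size (r n) = size (L n) by rewrite size_map size_iota.
have r1 n p : p \in r n -> `|p.1| <= 1 /\ `|p.2| <= 1.
  move=> /mapP[i]; rewrite mem_iota add0n => /andP[_ iL] -> /=.
  by have [] := ptP n i iL; have [] := f0 (ix n i).
pose psi n := wavg (r n).
have psi0 : weak_star_null psi.
  apply: (@wtensor_weak_star_null _ _ _ _ 1) => [n|y z].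
    by apply: wavg_norm; exact: r1.
  (* The [f] contribute a factor [`|y|], the means of the [h] are small. *)
  have bound n : `|psi n (wtensor_of [:: (y, z)])| <= `|y| * `|z| * n.+1%:R^-1.
    have [Ln0 _ LS] := LP n.
    have L0 : 0 < (size (L n))%:R :> R by rewrite ltr0n lt0n size_eq0.
    rewrite /psi wavgE sr normrM ger0_norm ?invr_ge0 ?(ltW L0)// ler_pdivrMl//.
    rewrite big_map; apply: le_trans (ler_norm_sum _ _ _) _.
    apply: (@le_trans _ _ (\sum_(i <- iota 0 (size (L n))) `|y| * `|(pt n i).1 z|)).
      rewrite !big_seq; apply: ler_sum => i _ /=.
      rewrite wtensor_ofE big_seq1 linearZ/= -[X in `|X|]/((f (ix n i) y : R) * _).
      rewrite normrM ler_wpM2r//; have [_ fi1] := f0 (ix n i).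
      by apply: le_trans (ler_dual _ _) _; rewrite ler_piMl.
    rewrite -mulr_sumr.
    have -> : \sum_(i <- iota 0 (size (L n))) `|(pt n i).1 z| = \sum_(p <- L n) `|p.1 z|.
      by rewrite [RHS](big_nth (0, 0)) /index_iota subn0.
    apply: le_trans (ler_wpM2l (normr_ge0 y) (LS z)) _.
    have E' (a b u v : R) : a * (u * v * b) = v * (a * b * u) by ring.
    by rewrite E'.
  apply/cvgrPdist_le => e e0.
  have yz1 : 0 < `|y| * `|z| + 1 by rewrite ltr_wpDl// mulr_ge0.
  have ey : 0 < e / (`|y| * `|z| + 1) by rewrite divr_gt0.
  near=> n; rewrite sub0r normrN; apply: le_trans (bound n) _.
  apply: (@le_trans _ _ ((`|y| * `|z| + 1) * (e / (`|y| * `|z| + 1)))); last first.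
    by rewrite mulrC divfK// gt_eqF.
  apply: ler_pM; rewrite ?mulr_ge0 ?invr_ge0 ?lerDl//.
  apply: ltW; near: n; exact: (near_infty_natSinv_lt (PosNum ey)).
pose prs N := [seq (n, i) | n <- iota 0 N.+1, i <- iota 0 (size (L n))].
pose U N := [seq (x (ix p.1 p.2), (pt p.1 p.2).2) | p <- prs N].
have prs_uniq N : uniq (prs N).
  apply: allpairs_uniq_dep => [||[n i] [n' i'] _ _ /= [-> ->]//].
    exact: iota_uniq.
  by move=> n _; exact: iota_uniq.
have prsP N p : p \in prs N -> (p.2 < size (L p.1))%N.
  by move=> /allpairsPdep[n [i [_]]]; rewrite mem_iota add0n => /andP[_ iL] ->.
have prs_mem N n i : (n <= N)%N -> (i < size (L n))%N -> (n, i) \in prs N.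
  move=> nN iL; apply: allpairs_f_dep; rewrite mem_iota add0n//.
apply: (@not_grothendieck _ _ psi (fun N => wtensor_of (U N)) c (d / 4) psi0) => //.
- by rewrite divr_gt0.
- move=> N; have := @wtensor_of_norm _ _ _ (U N) 1 ler01.
  rewrite mulr1 big_map -(big_map (fun p => ix p.1 p.2) xpredT x) => h.
  apply: le_trans (h _) _; last by apply: sumx; rewrite map_inj_uniq.
  move=> _ /mapP[p pN -> /=]; split; first exact: (x0 _).1.
  by have [] := ptP _ _ (prsP _ _ pN).
- move=> n N nN; have [Ln0 _ _] := LP n.
  have L0 : 0 < (size (L n))%:R :> R by rewrite ltr0n lt0n size_eq0.
  rewrite /psi wavgE sr ler_pdivlMl// big_map.
  have -> : (size (L n))%:R * (d / 4) = \sum_(i <- iota 0 (size (L n))) (d / 4) :> R.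
    by rewrite big_const_seq count_predT size_iota iter_addr_0 mulr_natl.
  rewrite big_seq [leRHS]big_seq; apply: ler_sum => i.
  rewrite mem_iota add0n => /andP[_ iL] /=.
  have -> : (pt n i).1 (wtensor_of (U N) (f (ix n i))) =
      \sum_(p <- prs N) f (ix n i) (x (ix p.1 p.2)) * (pt n i).1 (pt p.1 p.2).2 :> R.
    rewrite wtensor_ofE big_map linear_sum; apply: eq_bigr => p _.
    by rewrite linearZ.
  rewrite (bigD1_seq (n, i))//=; last exact: prs_mem.
  have [fi0 fi1] := f0 (ix n i); have [xi0 dx] := x0 (ix n i).
  have [h1 v1 hv] := ptP n i iL.
  have diag : d / 2 <= f (ix n i) (x (ix n i)) * (pt n i).1 (pt n i).2 :> R.
    by apply: ler_pM => //; rewrite ?invr_ge0 ?(ltW d0).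
  have rest : `|\sum_(p <- prs N | p != (n, i))
      f (ix n i) (x (ix p.1 p.2)) * (pt n i).1 (pt p.1 p.2).2| <= d / 4.
    apply: le_trans (ler_norm_sum _ _ _) _.
    apply: (@le_trans _ _ (\sum_(p <- prs N | p != (n, i)) f (ix n i) (x (ix p.1 p.2)))).
      rewrite big_seq_cond [leRHS]big_seq_cond; apply: ler_sum => p /andP[pN _].
      have [_ w1 _] := ptP _ _ (prsP _ _ pN).
      have fx0 : 0 <= f (ix n i) (x (ix p.1 p.2)) :> R.
        by apply: dual_ge0 => //; exact: (x0 _).1.
      rewrite normrM (ger0_norm fx0) ler_piMr//.
      apply: le_trans (ler_dual _ _) _; rewrite -[leRHS]mul1r; exact: ler_pM.
    rewrite -big_filter.
    have := off (ix n i) [seq ix p.1 p.2 | p <- prs N & p != (n, i)].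
    rewrite big_map; apply; first by rewrite map_inj_uniq// filter_uniq.
    apply/mapP => -[p]; rewrite mem_filter => /andP[pn _] /ix_inj pE.
    by rewrite -pE eqxx in pn.
  move: rest; rewrite ler_norml => /andP[rest _].
  apply: le_trans (_ : d / 2 - d / 4 <= _); first lra.
  exact: lerD.
Unshelve. all: by end_near. Qed.

End WittstockKB.

Theorem theorem2 (R : realType) (E F : banachLatticeType R) :
  infinite_dimensional E -> infinite_dimensional F ->
  ~ reflexive_space E ->
  ~ grothendieck (wtensor E F) \/ (~ bpap (dual E) /\ ~ bpap (dual F)).
Proof.
move=> _ Finf nrefl; left => GW; apply: nrefl.
have [y y0] : exists y : F, y != 0.
  apply: contrapT => h; apply: Finf; exists 0%N, (fun=> 0) => y _.
  exists (fun=> 0); rewrite big_ord0; apply/eqP/negP => /negP y0.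
  by apply: h; exists y.
apply: kb_reflexive; first exact: grothendieck_kb Finf GW.
exact: grothendieck_kb_dual y0 GW.
Qed.
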